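(* Let $\{b_n : n\ge 1\}$ be the partial quotient sequence of the Engel continued fraction (ECF) expansion, regarded as a sequence of random variables on $(0,1]$ with Lebesgue measure $\mathbf{P}$. Then the sequence $\left\{\frac{\log b_n - n}{n} : n\ge 1\right\}$ satisfies a large deviation principle with speed $n$ and good rate function $$I(x)=\begin{cases} x-\log(x+1), & \text{if } x>-\frac{\sqrt5-1}{2};\\[2pt] -\frac{\sqrt5+1}{2}(x+1)+2\log\frac{\sqrt5+1}{2}, & \text{if } -1\le x\le -\frac{\sqrt5-1}{2};\\[2pt] +\infty, & \text{otherwise.}\end{cases}$$
   Context: Probability space: $\Omega=(0,1]$ with its Borel $\sigma$-algebra and $\mathbf{P}$ = Lebesgue measure. ECF map: $T_E x=\frac{1}{[1/x]}\left(\frac1x-\left[\frac1x\right]\right)$, where $[\cdot]$ is the integer part. Partial quotients: $b_1(x)=[1/x]$ and $b_{n+1}(x)=b_1(T_E^n x)$ for $n\ge1$. For every irrational $x\in(0,1)$ all iterates $T_E^n x$ are irrational numbers in $(0,1)$, so all $b_n(x)$ are defined; thus the $b_n$ are defined $\mathbf{P}$-almost everywhere, take values in the positive integers, and satisfy $b_{n+1}\ge b_n$. A good rate function is a function $I:\mathbb{R}\to[0,\infty]$ that is lower semi-continuous and has compact level sets $\{x: I(x)\le c\}$, $c<\infty$. A sequence of real random variables $\{X_n\}$ satisfies a large deviation principle with speed $n$ and good rate function $I$ if for every Borel set $\Gamma\subseteq\mathbb{R}$, $$-\inf_{x\in\Gamma^\circ}I(x)\le\liminf_{n\to\infty}\frac1n\log\mathbf{P}(X_n\in\Gamma)\le\limsup_{n\to\infty}\frac1n\log\mathbf{P}(X_n\in\Gamma)\le-\inf_{x\in\overline\Gamma}I(x),$$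 where $\Gamma^\circ$ and $\overline\Gamma$ are the interior and closure of $\Gamma$. Conventions: $\log$ is the natural logarithm, $\log 0=-\infty$, $\inf\emptyset=+\infty$. *)

(* Defs.v *)
From HB Require Import structures.
From mathcomp Require Import all_boot all_order all_algebra.
From mathcomp Require Import all_classical all_reals all_analysis.
From mathcomp Require Import measurable_realfun ereal_normedtype.

Set Implicit Arguments.
Unset Strict Implicit.
Unset Printing Implicit Defensive.

Import Order.TTheory GRing.Theory Num.Theory.
Import numFieldNormedType.Exports.

Local Open Scope classical_set_scope.
Local Open Scope ring_scope.

Definition good_rate_function (R : realType) (I : R -> \bar R) : Prop :=
  [/\ forall x, (0 <= I x)%E,
      lower_semicontinuous I &
      forall c : R, compact [set x | (I x <= c%:E)%E]].

(* The term of index n = 0 is irrelevant to the limits.  [lne] is the natural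
   logarithm with [lne 0 = -oo], and [ereal_inf set0 = +oo]. *)
Definition large_deviation_principle (d : measure_display)
    (T : measurableType d) (R : realType) (P : probability T R)
    (X : nat -> {RV P >-> R}) (I : R -> \bar R) : Prop :=
  good_rate_function I /\
  forall G : set R, measurable G ->
    let rate n := ((n%:R^-1)%:E * lne (P (X n @^-1` G)))%E in
    [/\ (- ereal_inf [set I x | x in G°] <= limn_einf rate)%E,
        (limn_einf rate <= limn_esup rate)%E &
        (limn_esup rate <= - ereal_inf [set I x | x in closure G])%E].

Section uniform_law.
Context (R : realType).

(* The probability space (0, 1] with Lebesgue measure, presented as the
   probability on the Borel line that is concentrated on (0, 1]. *)
Definition lebesgue01 : set (measurableTypeR R) -> \bar R :=
  mrestr lebesgue_measure (measurable_itv `]0, 1]).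

HB.instance Definition _ := Measure.on lebesgue01.

Lemma lebesgue01_setT : lebesgue01 setT = 1%E.
Proof.
by rewrite /lebesgue01 /mrestr setTI lebesgue_measure_itv/= lte01 sube0.
Qed.

HB.instance Definition _ :=
  Measure_isProbability.Build _ _ _ lebesgue01 lebesgue01_setT.

End uniform_law.

Section engel_continued_fraction.
Context (R : realType).

Definition ecf_b1 (x : R) : int := Num.floor x^-1.

Definition ecf_map (x : R) : R :=
  ((ecf_b1 x)%:~R)^-1 * (x^-1 - (ecf_b1 x)%:~R).

(* Partial quotients are indexed from 1: b_n(x) = b_1(T_E^(n-1) x).  Because of
   the total inverse, b_n(x) takes a junk value for the rational x in (0, 1]
   whose expansion has stopped before rank n; these x are negligible. *)
Definition ecf_b (n : nat) (x : R) : int := ecf_b1 (iter n.-1 ecf_map x).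

Definition ecf_log_dev (n : nat) : measurableTypeR R -> R := fun x =>
  (ln (ecf_b n x)%:~R - n%:R) / n%:R.

Lemma measurable_invr : measurable_fun [set: R] (@GRing.inv R).
Proof.
have m1 : measurable [set 0 : R] by exact: measurable_set1.
rewrite -(setvU [set (0:R)]).
apply/measurable_funU => //; first exact: measurableC.
split; last exact: measurable_fun_set1.
apply: open_continuous_measurable_fun.
  by apply: closed_openC; exact: closed_eq.
by move=> x; rewrite inE/= => /eqP x0; exact: inv_continuous.
Qed.

Lemma measurable_ecf_b1 :
  measurable_fun [set: R] (fun x => (ecf_b1 x)%:~R : R).
Proof.
apply: (measurableT_comp (f := fun x : R => (Num.floor x)%:~R : R)).
  apply: nondecreasing_measurable => // x y xy.
  by rewrite ler_int; exact: le_floor.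
exact: measurable_invr.
Qed.

Lemma measurable_ecf_map : measurable_fun [set: R] ecf_map.
Proof.
apply: measurable_funM.
  by apply: measurableT_comp; [exact: measurable_invr|exact: measurable_ecf_b1].
by apply: measurable_funB; [exact: measurable_invr|exact: measurable_ecf_b1].
Qed.

Lemma measurable_ecf_iter n : measurable_fun [set: R] (iter n ecf_map).
Proof.
elim: n => [|n IHn]; first exact: measurable_id.
exact: measurableT_comp measurable_ecf_map IHn.
Qed.

Lemma measurable_ecf_log_dev n : measurable_fun setT (ecf_log_dev n).
Proof.
apply: measurable_funM => //; apply: measurable_funB => //.
apply: measurableT_comp; first exact: measurable_ln.
exact: measurableT_comp measurable_ecf_b1 (measurable_ecf_iter _).
Qed.

HB.instance Definition _ n :=
  isMeasurableFun.Build _ _ _ _ (ecf_log_dev n) (measurable_ecf_log_dev n).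

Definition ecf_log_dev_RV (n : nat) : {RV (@lebesgue01 R) >-> R} :=
  ecf_log_dev n.

Definition ecf_rate (x : R) : \bar R :=
  let s := Num.sqrt 5 in
  if - ((s - 1) / 2) < x then (x - ln (x + 1))%:E
  else if -1 <= x then (- ((s + 1) / 2) * (x + 1) + 2 * ln ((s + 1) / 2))%:E
  else +oo%E.

End engel_continued_fraction.

(* Main.v *)
Require Import Defs.
From mathcomp Require Import all_boot all_order all_algebra.
From mathcomp Require Import all_classical all_reals all_analysis.
From mathcomp Require Import measurable_realfun ring lra.

(** Write g = (sqrt 5 - 1) / 2, so that g^2 = 1 - g and 1 / g = 1 + g.

    Given b_1, ..., b_n, the point T_E^n x has on [0, 1/b), b = b_n, a density of
    the form (b + r) / (1 + r t)^2 with r in [0, 1], and the pair (b, r) is a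
    Markov chain started from (1, 0): it jumps to (k, k / (k + r)), k >= b, with
    probability (b + r) / ((k + r) (k + r + 1)). To avoid conditional laws, these
    densities are presented through their quantile functions; in the uniform
    coordinate each branch of T_E is affine, so the whole description only needs
    the behaviour of Lebesgue measure under affine maps. The outcome,
    [quantile_event_iter] and [lebesgue01_ecf], is that P(b_n in A) is the n-th
    iterate of the transition operator of the chain, applied to the indicator
    of A and evaluated at (1, 0). All estimates are made on this operator.

    When b is large, ln b_n makes nearly independent exponential steps of mean 1,
    which suggests that the moment of b_n of order t < 1 grows like
    (1 / (1 - t))^n. The only competing behaviour is to remain at the quotient 1,
    which has probability of order (g^2)^n. Hence the logarithmic growth rate of
    the moments is the maximum of - ln (1 - t) and 2 ln g. The upper half is
    [moment_upper], proved with an explicit function that the operator multiplies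
    by at most l; the lower half for the first term is [moment_lower], and the
    second term comes from an exact eigenfunction of the operator restricted to
    b = 1 ([stay_weightE]). The two terms agree at t = - (1 + g), which is the
    slope of the affine branch of the rate function.

    The upper bound of the large deviation principle then follows from
    exponential Chebyshev inequalities on both sides of 0 ([right_tail],
    [left_tail]), because the rate function is monotone on each side. For the
    lower bound at a speed z = 1 + x > g^2, the moment of order t = 1 - 1/z is
    concentrated on ln b_n close to z n ([window_lower]). The speeds z <= g^2 are
    not derivatives of the growth rate, which has a corner at t = - (1 + g); they
    are reached by first repeating the quotient 1 during a fixed proportion of
    the time ([stay_then], [window_lower_rate]), and the cost of this mixture is
    the affine branch. *)

Set Implicit Arguments.
Unset Strict Implicit.
Unset Printing Implicit Defensive.

Import Order.TTheory GRing.Theory Num.Theory.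
Import numFieldNormedType.Exports.

Local Open Scope classical_set_scope.
Local Open Scope ring_scope.

(** * The Markov chain behind the partial quotients *)

Section transfer_operator.
Context {R : realType}.
Implicit Types (b k j n : nat) (r : R) (f g : nat -> R -> \bar R).

(** A state (b, r) stands for the law on [0, 1/b) with density
    (b + r) / (1 + r t)^2: for a suitable r it is the law of T_E^n x given
    b_1, ..., b_n, with b = b_n. *)
Definition state b r := (0 < b)%N && (0 <= r <= 1).

Definition step_prob b r k : R :=
  (b%:R + r) / ((k%:R + r) * (k%:R + r + 1)).

(** Conditioning the law (b, r) on b_1 = k and applying T_E yields the law
    (k, k / (k + r)). *)
Definition next_r k r : R := k%:R / (k%:R + r).

(** The sum runs over the increment j = k - b, so that the term j = 0 is the
    repetition of the quotient b. *)
Definition transfer f b r : \bar R :=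
  (\sum_(j <oo) (step_prob b r (b + j))%:E
                * f (b + j)%N (next_r (b + j) r))%E.

Lemma state_gt0 b r : state b r -> 0 < b%:R :> R.
Proof. by case/andP; rewrite ltr0n. Qed.

Lemma state_r b r : state b r -> 0 <= r <= 1.
Proof. by case/andP. Qed.

Lemma state_ge1 b r : state b r -> 1 <= b%:R :> R.
Proof. by case/andP; rewrite ler1n. Qed.

Lemma state_addr b j r : state b r -> state (b + j) r.
Proof. by case/andP => b0 r01; rewrite /state addn_gt0 b0. Qed.

Lemma state_next b r : state b r -> state b (next_r b r).
Proof.
move=> s; have /andP[b0 /andP[r0 r1]] := s; have b1 := state_ge1 s.
rewrite /state b0 /next_r divr_ge0 ?addr_ge0//=.
by rewrite ler_pdivrMr; lra.
Qed.

Lemma step_prob_ge0 b r k : state b r -> 0 <= step_prob b r k.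
Proof.
move=> s; have /andP[r0 r1] := state_r s.
by rewrite /step_prob divr_ge0 ?mulr_ge0 ?addr_ge0.
Qed.

Lemma transfer_ge0 f b r : (forall b r, state b r -> 0 <= f b r)%E ->
  state b r -> (0 <= transfer f b r)%E.
Proof.
move=> f0 s; apply: nneseries_ge0 => j _ _.
by rewrite mule_ge0 ?lee_fin ?step_prob_ge0// f0// state_next// state_addr.
Qed.

Lemma le_transfer f g b r : (forall b r, state b r -> 0 <= f b r)%E ->
  (forall b r, state b r -> f b r <= g b r)%E ->
  state b r -> (transfer f b r <= transfer g b r)%E.
Proof.
move=> f0 fg s; apply: lee_nneseries => j.
  move=> _ _; rewrite mule_ge0 ?lee_fin ?step_prob_ge0// f0//.
  by rewrite state_next// state_addr.
move=> _; rewrite lee_wpmul2l ?lee_fin ?step_prob_ge0// fg//.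
by rewrite state_next// state_addr.
Qed.

Lemma transferZ f (c : R) b r : (forall b r, state b r -> 0 <= f b r)%E ->
  state b r -> transfer (fun b r => c%:E * f b r)%E b r = (c%:E * transfer f b r)%E.
Proof.
move=> f0 s; rewrite -nneseriesZl; last first.
  by move=> j _; rewrite mule_ge0 ?lee_fin ?step_prob_ge0// f0// state_next//
    state_addr.
by apply: eq_eseriesr => j _; rewrite muleCA.
Qed.

Lemma transferD f g b r : (forall b r, state b r -> 0 <= f b r)%E ->
  (forall b r, state b r -> 0 <= g b r)%E -> state b r ->
  transfer (fun b r => f b r + g b r)%E b r = (transfer f b r + transfer g b r)%E.
Proof.
move=> f0 g0 s; rewrite -nneseriesD; last 2 first.
- by move=> j _ _; rewrite mule_ge0 ?lee_fin ?step_prob_ge0// f0// state_next//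
  state_addr.
- by move=> j _ _; rewrite mule_ge0 ?lee_fin ?step_prob_ge0// g0// state_next//
  state_addr.
by apply: eq_eseriesr => j _; rewrite ge0_muleDr// ?f0 ?g0// state_next//
  state_addr.
Qed.

Lemma eq_transfer f g b r : (forall b r, state b r -> f b r = g b r) ->
  state b r -> transfer f b r = transfer g b r.
Proof. by move=> fg s; apply: eq_eseriesr => j _; rewrite fg// state_next//
  state_addr. Qed.

Lemma iter_transfer_ge0 n f : (forall b r, state b r -> 0 <= f b r)%E ->
  forall b r, state b r -> (0 <= iter n transfer f b r)%E.
Proof. by move=> f0; elim: n => [|n ih] b r s /=; [exact: f0|exact:
  transfer_ge0]. Qed.

Lemma le_iter_transfer n f g : (forall b r, state b r -> 0 <= f b r)%E ->
  (forall b r, state b r -> f b r <= g b r)%E ->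
  forall b r, state b r -> (iter n transfer f b r <= iter n transfer g b r)%E.
Proof.
move=> f0 fg; elim: n => [|n ih] b r s /=; first exact: fg.
by apply: le_transfer => //; exact: iter_transfer_ge0.
Qed.

Lemma iter_transferZ n f (c : R) : (forall b r, state b r -> 0 <= f b r)%E ->
  forall b r, state b r ->
  iter n transfer (fun b r => c%:E * f b r)%E b r = (c%:E * iter n transfer f b
    r)%E.
Proof.
move=> f0; elim: n => [//|n ih] b r s /=; rewrite -transferZ//; last exact:
  iter_transfer_ge0.
exact: eq_transfer.
Qed.

Lemma iter_transferD n f g : (forall b r, state b r -> 0 <= f b r)%E ->
  (forall b r, state b r -> 0 <= g b r)%E ->
  forall b r, state b r ->
  iter n transfer (fun b r => f b r + g b r)%E b r =
  (iter n transfer f b r + iter n transfer g b r)%E.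
Proof.
move=> f0 g0; elim: n => [//|n ih] b r s /=; rewrite -transferD//; try exact:
  iter_transfer_ge0.
exact: eq_transfer.
Qed.

(** All iterates are controlled at once by a function that one application of
    the operator multiplies by at most l, or by at least l in the next lemma. *)
Lemma iter_transfer_le n (W : nat -> R -> R) (l : R) : 0 <= l ->
  (forall b r, state b r -> 0 <= W b r) ->
  (forall b r, state b r -> transfer (fun b r => (W b r)%:E) b r <= (l * W b
    r)%:E)%E ->
  forall b r, state b r ->
  (iter n transfer (fun b r => (W b r)%:E) b r <= (l ^+ n * W b r)%:E)%E.
Proof.
move=> l0 W0 Wl; elim: n => [|n ih] b r s /=; first by rewrite mul1r.
apply: (@le_trans _ _ (transfer (fun b r => (l ^+ n)%:E * (W b r)%:E)%E b r)).
  by apply: le_transfer => //; exact: iter_transfer_ge0.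
rewrite transferZ// exprSr -mulrA EFinM lee_wpmul2l ?lee_fin ?exprn_ge0//.
exact: Wl.
Qed.

Lemma iter_transfer_ge n (W : nat -> R -> R) (l : R) : 0 <= l ->
  (forall b r, state b r -> 0 <= W b r) ->
  (forall b r, state b r -> (l * W b r)%:E <= transfer (fun b r => (W b r)%:E) b
    r)%E ->
  forall b r, state b r ->
  ((l ^+ n * W b r)%:E <= iter n transfer (fun b r => (W b r)%:E) b r)%E.
Proof.
move=> l0 W0 Wl; elim: n => [|n ih] b r s /=; first by rewrite mul1r.
apply: (@le_trans _ _ (transfer (fun b r => (l ^+ n)%:E * (W b r)%:E)%E b r)).
  rewrite transferZ// exprSr -mulrA EFinM lee_wpmul2l ?lee_fin ?exprn_ge0//.
  exact: Wl.
apply: le_transfer => // b' r' s'.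
by rewrite -EFinM lee_fin mulr_ge0 ?exprn_ge0 ?W0.
Qed.

End transfer_operator.

(** * Power functions under the transfer operator *)

Section telescoping.
Context {R : realType}.
Implicit Types (a u : nat -> R).

Lemma nneseries_le_telescope a u : (forall j, 0 <= a j) -> (forall j, 0 <= u j) ->
  (forall j, a j <= u j - u j.+1) ->
  (\sum_(j <oo) (a j)%:E <= (u 0%N)%:E)%E.
Proof.
move=> a0 u0 au; apply: lime_le.
  by apply: is_cvg_nneseries => n _ _; rewrite lee_fin.
apply: nearW => n; rewrite sumEFin lee_fin.
apply: (@le_trans _ _ (u 0%N - u n)); last by rewrite gerBl.
elim: n => [|n ih]; first by rewrite big_geq// subrr.
by rewrite big_nat_recr//=; have := au n; lra.
Qed.

Lemma nneseries_ge_telescope a u : (forall j, 0 <= a j) ->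
  (forall e, 0 < e -> exists n, u n <= e) ->
  (forall j, u j - u j.+1 <= a j) ->
  ((u 0%N)%:E <= \sum_(j <oo) (a j)%:E)%E.
Proof.
move=> a0 u0 au; apply/lee_addgt0Pr => e /u0[n un].
apply: (@le_trans _ _ ((\sum_(0 <= j < n) (a j)%:E) + e%:E)%E); last first.
  by rewrite leeD2r//; apply: nneseries_lim_ge => j _ _; rewrite lee_fin.
rewrite sumEFin -EFinD lee_fin.
suff : u 0%N - u n <= \sum_(0 <= j < n) a j by lra.
elim: n {un} => [|n ih]; first by rewrite big_geq// subrr.
by rewrite big_nat_recr//=; have := au n; lra.
Qed.

End telescoping.

Section powers.
Context {R : realType}.
Implicit Types (t r : R) (b k n : nat).

Definition natpow t k : R := expR (t * ln k%:R).

Lemma natpow_gt0 t k : 0 < natpow t k. Proof. exact: expR_gt0. Qed.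

Lemma natpow_ge0 t k : 0 <= natpow t k. Proof. exact: expR_ge0. Qed.

Lemma natpow1 t : natpow t 1 = 1.
Proof. by rewrite /natpow ln1 mulr0 expR0. Qed.

Lemma natpowD s t k : natpow (s + t) k = natpow s k * natpow t k.
Proof. by rewrite /natpow mulrDl expRD. Qed.

Lemma natpow_id k : (0 < k)%N -> natpow 1 k = k%:R.
Proof. by move=> k0; rewrite /natpow mul1r lnK// posrE ltr0n. Qed.

Lemma le_lnB1 (x : R) : 0 < x -> ln x <= x - 1.
Proof.
move=> x0; have -> : ln x = ln (1 + (x - 1)) by congr ln; ring.
by apply: le_ln1Dx; lra.
Qed.

Lemma ln_succ_ge k : (0 < k)%N -> k.+1%:R^-1 <= ln k.+1%:R - ln k%:R :> R.
Proof.
move=> k0; have k0' : 0 < k%:R :> R by rewrite ltr0n.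
have := @le_lnB1 (k%:R / k.+1%:R); rewrite divr_gt0// => /(_ isT).
rewrite ln_div ?posrE// => h.
have -> : k.+1%:R^-1 = 1 - k%:R / k.+1%:R :> R.
  by rewrite -natr1; field; rewrite natr1 pnatr_eq0.
by rewrite -opprB -[leRHS]opprB lerN2.
Qed.

Lemma ln_succ_le k : (0 < k)%N -> ln k.+1%:R - ln k%:R <= k%:R^-1 :> R.
Proof.
move=> k0; have k0' : 0 < k%:R :> R by rewrite ltr0n.
have := @le_lnB1 (k.+1%:R / k%:R); rewrite divr_gt0// => /(_ isT).
rewrite ln_div ?posrE// => h; apply: (le_trans h).
by rewrite -natr1 mulrDl mul1r divff ?gt_eqF// addrC addKr.
Qed.

Lemma natpowN_succ s k : natpow (- s) k =
  natpow (- s) k.+1 * expR (s * (ln k.+1%:R - ln k%:R)).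
Proof. by rewrite /natpow -expRD; congr expR; ring. Qed.

(** Convexity of the power k^-s, from exp x >= 1 + x; this and the next lemma
    compare the terms k^-(s+1) with a telescoping sequence. *)
Lemma natpowN_diff_ge s k : 0 < s -> (0 < k)%N ->
  s * natpow (- s) k.+1 / k.+1%:R <= natpow (- s) k - natpow (- s) k.+1.
Proof.
move=> s0 k0; rewrite [natpow _ k]natpowN_succ.
have := natpow_gt0 (- s) k.+1; set q := natpow _ _ => q0.
have h : 1 + s / k.+1%:R <= expR (s * (ln k.+1%:R - ln k%:R)).
  by apply: le_trans (expR_ge1Dx _); rewrite lerD2l ler_wpM2l ?(ltW s0)//
    ln_succ_ge.
have -> : s * q / k.+1%:R = q * (1 + s / k.+1%:R) - q by ring.
by rewrite lerD2r ler_wpM2l// ltW.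
Qed.

Lemma natpowN_diff_le s k : 0 < s -> (0 < k)%N ->
  natpow (- s) k - natpow (- s) k.+1 <= s * natpow (- s) k / k%:R.
Proof.
move=> s0 k0.
have -> : natpow (- s) k.+1 = natpow (- s) k * expR (- (s * (ln k.+1%:R - ln
  k%:R))).
  by rewrite /natpow -expRD; congr expR; ring.
have := natpow_gt0 (- s) k; set q := natpow _ _ => q0.
have h : 1 - s / k%:R <= expR (- (s * (ln k.+1%:R - ln k%:R))).
  by apply: le_trans (expR_ge1Dx _); rewrite lerD2l lerN2 ler_wpM2l ?(ltW s0)//
    ln_succ_le.
have -> : s * q / k%:R = q - q * (1 - s / k%:R) by ring.
by rewrite lerD2l lerN2 ler_wpM2l// ltW.
Qed.

Lemma natpowN_small s e : 0 < s -> 0 < e -> exists n, natpow (- s) n <= e.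
Proof.
move=> s0 e0.
have [x xe] : exists x : R, x = expR (- ln e / s) by eexists.
exists (Num.truncn x).+1; rewrite /natpow -[leRHS]lnK ?posrE// ler_expR.
have h : ln x <= ln (Num.truncn x).+1%:R.
  have x0 : 0 < x by rewrite xe expR_gt0.
  rewrite ler_ln ?posrE// ltW//; exact: truncnS_gt.
move: h; rewrite {1}xe expRK ler_pdivrMr// => h; lra.
Qed.

Lemma natpowN_antitone s m n : 0 <= s -> (0 < m)%N -> (m <= n)%N ->
  natpow (- s) n <= natpow (- s) m.
Proof.
move=> s0 m0 mn; rewrite ler_expR !mulNr lerN2 ler_wpM2l// ler_ln ?ler_nat//
  posrE ltr0n//.
exact: leq_trans mn.
Qed.

Lemma step_prob_le b r k : state b r -> (b <= k)%N ->
  step_prob b r k <= (b%:R + 1) / (k%:R * k.+1%:R).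
Proof.
move=> s bk; have /andP[r0 r1] := state_r s; have b1 := state_ge1 s.
have k1 : 1 <= k%:R :> R by apply: le_trans b1 _; rewrite ler_nat.
rewrite /step_prob; apply: ler_pM; [lra|by rewrite invr_ge0; apply: mulr_ge0;
  lra|lra|].
rewrite lef_pV2 ?posrE; try by apply: mulr_gt0; lra.
by rewrite -natr1; apply: ler_pM; lra.
Qed.

Lemma step_prob_ge b r k : state b r -> (b <= k)%N ->
  b%:R / (k.+1%:R * k.+2%:R) <= step_prob b r k.
Proof.
move=> s bk; have /andP[r0 r1] := state_r s; have b1 := state_ge1 s.
have k1 : 1 <= k%:R :> R by apply: le_trans b1 _; rewrite ler_nat.
rewrite /step_prob; apply: ler_pM; [lra|by rewrite invr_ge0|lra|].
rewrite lef_pV2 ?posrE; try by apply: mulr_gt0; rewrite -?natr1; lra.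
by rewrite -[k.+2%:R]natr1 -natr1; apply: ler_pM; lra.
Qed.

(** The exponent t - 1 < 0 is the one whose increments telescope. *)
Lemma natpow_split t k : (0 < k)%N -> natpow t k = k%:R * natpow (- (1 - t)) k.
Proof.
move=> k0; have tE : t = 1 + - (1 - t) by ring.
by rewrite {1}tE natpowD natpow_id.
Qed.

(** Each term of the series is at most a constant times the increment of the
    decreasing sequence k^-(1-t), so the series telescopes. The constant tends
    to 1 / (1 - t) as b grows: far from 0 the chain ln b_n moves like a random
    walk with exponential steps X of mean 1, for which E (exp (t X)) is
    1 / (1 - t). *)
Lemma transfer_natpow_le t b r : t < 1 -> state b r ->
  (transfer (fun k _ => (natpow t k)%:E) b r <=
   (expR ((2 - t) / b%:R) / (1 - t) * natpow t b)%:E)%E.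
Proof.
move=> t1 st; have b1 := state_ge1 st; have b0 : (0 < b)%N by case/andP: st.
have [s st1] : exists s, s = 1 - t by eexists.
have s0 : 0 < s by lra.
have [c cE] : exists c, c = (b%:R + 1) * expR (s / b%:R) / s by eexists.
have c0 : 0 <= c by rewrite cE divr_ge0 ?mulr_ge0 ?expR_ge0//; lra.
apply: (@le_trans _ _ (c * natpow (- s) b)%:E); last first.
  rewrite lee_fin cE (natpow_split t b0) -st1.
  have -> : (2 - t) / b%:R = s / b%:R + b%:R^-1 by rewrite st1; ring.
  rewrite expRD; set e := expR (s / _); set q := natpow _ _.
  have h := @expR_ge1Dx R b%:R^-1.
  have -> : (b%:R + 1) * e / s * q = (e / s * q * b%:R) * (1 + b%:R^-1).
    by field; rewrite ?gt_eqF//; lra.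
  have -> : e * expR b%:R^-1 / s * (b%:R * q) = (e / s * q * b%:R) * expR b%:R^-1
    by ring.
  by rewrite ler_wpM2l// !mulr_ge0 ?invr_ge0 ?expR_ge0//; lra.
rewrite /transfer -[X in natpow (- s) X]addn0.
under eq_eseriesr do rewrite -EFinM.
apply: (@nneseries_le_telescope _ _ (fun j => c * natpow (- s) (b + j))) => j.
- by rewrite mulr_ge0 ?natpow_ge0// step_prob_ge0.
- by rewrite mulr_ge0 ?natpow_ge0.
have bj := leq_addr j b; rewrite addnS; set k := (b + j)%N in bj *.
have k0 : (0 < k)%N by exact: leq_trans bj.
have k0' : 0 < k%:R :> R by rewrite ltr0n.
have h1 := step_prob_le st bj.
have h2 := natpowN_diff_ge s0 k0.
have h3 : natpow (- s) k <= natpow (- s) k.+1 * expR (s / b%:R).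
  rewrite natpowN_succ ler_wpM2l ?natpow_ge0// ler_expR ler_wpM2l ?(ltW s0)//.
  apply: le_trans (ln_succ_le k0) _.
  by rewrite lef_pV2 ?posrE// ?ler_nat//; lra.
rewrite -mulrBr (natpow_split t k0) -st1.
apply: (@le_trans _ _ ((b%:R + 1) / k.+1%:R * natpow (- s) k)).
  have -> : (b%:R + 1) / k.+1%:R * natpow (- s) k =
    (b%:R + 1) / (k%:R * k.+1%:R) * (k%:R * natpow (- s) k).
    by field; rewrite !gt_eqF//; lra.
  by rewrite ler_wpM2r// mulr_ge0 ?natpow_ge0// ltW.
apply: (@le_trans _ _ (c * (s * natpow (- s) k.+1 / k.+1%:R))); last exact:
  ler_wpM2l.
have -> : c * (s * natpow (- s) k.+1 / k.+1%:R) =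
  (b%:R + 1) / k.+1%:R * (natpow (- s) k.+1 * expR (s / b%:R)).
  by rewrite cE; field; rewrite !gt_eqF//; lra.
by rewrite ler_wpM2l// divr_ge0//; lra.
Qed.

Lemma ratio_succ_ge k m : (0 < m)%N -> (m <= k)%N ->
  expR (- m%:R^-1) <= k%:R / k.+1%:R :> R.
Proof.
move=> m0 mk; have k0 : (0 < k)%N by exact: leq_trans mk.
have m0' : 0 < m%:R :> R by rewrite ltr0n.
have k0' : 0 < k%:R :> R by rewrite ltr0n.
rewrite -[leRHS]lnK ?posrE ?divr_gt0// ler_expR ln_div ?posrE//.
rewrite lerNl opprB; apply: le_trans (ln_succ_le k0) _.
by rewrite lef_pV2 ?posrE// ler_nat.
Qed.

(** Same comparison as for the upper estimate, with the increments of k^-(1-t)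
    bounded from the other side. *)
Lemma transfer_natpow_ge t b r : t < 1 -> state b r ->
  ((expR (- (3 / b%:R)) / (1 - t) * natpow t b)%:E <=
   transfer (fun k _ => (natpow t k)%:E) b r)%E.
Proof.
move=> t1 st; have b1 := state_ge1 st; have b0 : (0 < b)%N by case/andP: st.
have [s st1] : exists s, s = 1 - t by eexists.
have s0 : 0 < s by lra.
have [c cE] : exists c, c = b%:R * expR (- (3 / b%:R)) / s by eexists.
have c0 : 0 < c by rewrite cE divr_gt0 ?mulr_gt0 ?expR_gt0//; lra.
have -> : expR (- (3 / b%:R)) / (1 - t) * natpow t b = c * natpow (- s) (b + 0).
  by rewrite cE (natpow_split t b0) -st1 addn0; ring.
rewrite /transfer.
under eq_eseriesr do rewrite -EFinM.
apply: (@nneseries_ge_telescope _ _ (fun j => c * natpow (- s) (b + j))).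
- by move=> j; rewrite mulr_ge0 ?natpow_ge0// step_prob_ge0.
- move=> e e0; have [||n hn] := @natpowN_small s (e / c) => //; first by rewrite
  divr_gt0.
  exists n.+1; rewrite mulrC -ler_pdivlMr//; apply: le_trans hn.
  case: n => [|n].
    by rewrite /natpow [ln 0%:R]ln0// mulr0 ler_expR mulNr oppr_le0 mulr_ge0
      ?(ltW s0)// ln_ge0// ler1n addnS.
  apply: natpowN_antitone => //; first exact: ltW.
  by rewrite (leq_trans _ (leq_addl _ _)).
move=> j; have bj := leq_addr j b; rewrite addnS; set k := (b + j)%N in bj *.
have k0 : (0 < k)%N by exact: leq_trans bj.
have k0' : 0 < k%:R :> R by rewrite ltr0n.
have h1 := step_prob_ge st bj.
have h2 := natpowN_diff_le s0 k0.
rewrite -mulrBr (natpow_split t k0) -st1.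
apply: (@le_trans _ _ (c * (s * natpow (- s) k / k%:R))); first by rewrite
  ler_wpM2l// ltW.
apply: (@le_trans _ _ (b%:R / (k.+1%:R * k.+2%:R) * (k%:R * natpow (- s) k)));
  last first.
  by rewrite ler_wpM2r// mulr_ge0 ?natpow_ge0// ltW.
have -> : c * (s * natpow (- s) k / k%:R) =
   b%:R * natpow (- s) k / k%:R * expR (- (3 / b%:R)).
  by rewrite cE; field; rewrite !gt_eqF//; lra.
have -> : b%:R / (k.+1%:R * k.+2%:R) * (k%:R * natpow (- s) k) =
  b%:R * natpow (- s) k / k%:R * ((k%:R / k.+1%:R) * ((k%:R / k.+1%:R) * (k.+1%:R
    / k.+2%:R))).
  by field; rewrite !gt_eqF//; lra.
rewrite ler_wpM2l ?divr_ge0 ?mulr_ge0 ?natpow_ge0//.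
have -> : - (3 / b%:R) = - b%:R^-1 + (- b%:R^-1 + - b%:R^-1) :> R by lra.
rewrite !expRD ler_pM ?mulr_ge0 ?expR_ge0 ?ratio_succ_ge//.
rewrite ler_pM ?expR_ge0 ?ratio_succ_ge//.
by rewrite (leq_trans bj).
Qed.

End powers.

(** * Repeating the quotient 1 *)

Section golden.
Context {R : realType}.
Implicit Types (t r : R) (b k n : nat).

Definition golden : R := (Num.sqrt 5 - 1) / 2.

Local Notation g := golden.

Lemma golden_sqr : g ^+ 2 = 1 - g.
Proof.
have h : Num.sqrt 5 ^+ 2 = 5 :> R by rewrite sqr_sqrtr.
by rewrite /golden; move: h; set s := Num.sqrt _ => h; field: h.
Qed.

Lemma golden_bounds : 3 / 5 < g < 2 / 3.
Proof.
have h : Num.sqrt 5 ^+ 2 = 5 :> R by rewrite sqr_sqrtr.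
have h0 : 0 <= Num.sqrt 5 :> R by exact: sqrtr_ge0.
rewrite /golden; move: h h0; set s := Num.sqrt _ => h h0.
by apply/andP; split; nra.
Qed.

Lemma golden_gt0 : 0 < g.
Proof. by have /andP[? _] := golden_bounds; lra. Qed.

(** The density of the law (1, r) at the point g = 1 / (1 + g), which T_E fixes
    with all its partial quotients equal to 1. *)
Definition stay_weight r : R := (1 + r) / (1 + r * g) ^+ 2.

(** The branch b_1 = 1 has slope of modulus g^-2 at its fixed point g, so the
    density there is divided by g^-2 when the law is restricted to this branch
    and transported. Thus stay_weight is an eigenfunction of the operator
    restricted to b = 1, and g^2 is the exact price of one repetition of 1. *)
Lemma stay_weightE r : 0 <= r <= 1 ->
  step_prob 1 r 1 * stay_weight (next_r 1 r) = g ^+ 2 * stay_weight r.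
Proof.
move=> /andP[r0 r1]; have g2 := golden_sqr; have g0 := golden_gt0.
rewrite /step_prob /next_r /stay_weight.
have rg : 0 <= r * g by rewrite mulr_ge0// ltW.
have -> : 1 + 1%:R / (1%:R + r) * g = (1 + r * g) / (g * (1 + r)).
  apply: (@mulIf _ (g * (1 + r))); first by rewrite gt_eqF// mulr_gt0//; lra.
  rewrite divfK; last by rewrite gt_eqF// mulr_gt0//; lra.
  have -> : (1 + 1%:R / (1%:R + r) * g) * (g * (1 + r)) = g * (1 + r) + g ^+ 2.
    by field; rewrite gt_eqF//; lra.
  by rewrite g2; ring.
by field; rewrite !gt_eqF//; lra.
Qed.

Lemma stay_weight_bounds r : 0 <= r <= 1 -> 1 / 4 <= stay_weight r <= 2.
Proof.
move=> /andP[r0 r1]; have /andP[g0 g1] := golden_bounds.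
have rg : 0 <= r * g by rewrite mulr_ge0//; lra.
have rg1 : r * g <= 1 by rewrite mulr_ile1//; lra.
have h1 : 1 <= (1 + r * g) ^+ 2 by rewrite expr2; nra.
have h4 : (1 + r * g) ^+ 2 <= 4 by rewrite expr2; nra.
rewrite /stay_weight ler_pdivlMr ?ler_pdivrMr; lra.
Qed.

End golden.

(** * Exponential growth of the moments *)

Section upper_moment.
Context {R : realType}.
Implicit Types (t r : R) (b k n : nat).
Local Notation g := (@golden R).

(** With D large, a jump upwards divides the weight D^(B - b) by at least D, so
    that below the level B only the probability of repeating b counts. This
    probability is at most 1/3 < g^2 for b >= 2; for b = 1 it is replaced by g^2
    through the eigenfunction. The factor 4 makes 4 * stay_weight at least 1. *)
Definition low_weight (B : nat) (D : R) b r : R :=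
  if (b < B)%N then D ^+ (B - b) * (if b == 1%N then 4 * stay_weight r else 1)
  else 0.

Lemma low_weight_ge0 B D b r : 0 <= D -> state b r -> 0 <= low_weight B D b r.
Proof.
move=> D0 s; rewrite /low_weight; case: ifP => // _.
rewrite mulr_ge0 ?exprn_ge0//; case: ifP => // _.
by have /andP[h _] := stay_weight_bounds (state_r s); lra.
Qed.

Lemma transfer_low_weight0 B D b r : (B <= b)%N ->
  transfer (fun b r => (low_weight B D b r)%:E) b r = 0%E.
Proof.
move=> Bb; rewrite /transfer eseries0// => j _ _.
by rewrite /low_weight ltnNge (leq_trans Bb)/= ?leq_addr// mule0.
Qed.

Lemma step_prob_self_le b r : state b r -> (1 < b)%N -> step_prob b r b <= 1 / 3.
Proof.
move=> s b2; have /andP[r0 r1] := state_r s.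
have b2' : 2 <= b%:R :> R by rewrite ler_nat.
rewrite /step_prob ler_pdivrMr; last by apply: mulr_gt0; lra.
by nra.
Qed.

Lemma low_weight_stay B D b r : 1 <= D -> state b r -> (b < B)%N ->
  step_prob b r b * low_weight B D b (next_r b r) <= g ^+ 2 * low_weight B D b r.
Proof.
move=> D1 s bB; rewrite /low_weight bB.
have D0 : 0 <= D ^+ (B - b) by rewrite exprn_ge0//; lra.
case: eqVneq => [b1|bn1].
  rewrite b1 mulrCA [X in _ <= X]mulrCA ler_wpM2l -?b1//.
  by rewrite b1 mulrCA [X in _ <= X]mulrCA stay_weightE// (state_r s).
rewrite !mulr1 ler_wpM2r//; have b2 : (1 < b)%N.
  by rewrite ltn_neqAle eq_sym bn1; case/andP: s.
apply: (le_trans (step_prob_self_le s b2)); rewrite golden_sqr.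
by have /andP[_ ?] := @golden_bounds R; lra.
Qed.

Lemma transfer_low_weight_le B D b r : 1 <= D -> state b r -> (b < B)%N ->
  (transfer (fun b r => (low_weight B D b r)%:E) b r <=
   (g ^+ 2 * low_weight B D b r + D ^+ (B - b.+1))%:E)%E.
Proof.
move=> D1 s bB; have b1 := state_ge1 s; have /andP[r0 r1] := state_r s.
have D0 : 0 <= D by lra.
apply: (@le_trans _ _ (step_prob b r b * low_weight B D b (next_r b r) + D ^+ (B
  - b.+1))%:E); last first.
  by rewrite lee_fin lerD2r low_weight_stay.
set A := step_prob b r b * _; set E := D ^+ _.
have E0 : 0 <= E by rewrite exprn_ge0.
have A0 : 0 <= A by rewrite mulr_ge0 ?step_prob_ge0// low_weight_ge0// state_next.
rewrite /transfer; under eq_eseriesr do rewrite -EFinM.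
pose u j := (if j == 0%N then A else 0) + E * ((b%:R + r) / ((b + j)%:R + r)).
have -> : A + E = u 0%N by rewrite /u eqxx addn0 divff ?mulr1// gt_eqF//; lra.
apply: nneseries_le_telescope => j.
- by rewrite mulr_ge0 ?step_prob_ge0// low_weight_ge0// state_next// state_addr.
- by rewrite /u addr_ge0//; [case: ifP|rewrite mulr_ge0// divr_ge0//;
  [lra|rewrite addr_ge0]].
have bj : 1 <= (b + j)%:R :> R by rewrite (le_trans b1)// ler_nat leq_addr.
have uE : u j - u j.+1 = (if j == 0%N then A else 0) + E * step_prob b r (b + j).
  rewrite /u /step_prob/= addnS -natr1 add0r; move: (b + j)%:R bj => k k1.
  by rewrite -addrA; congr (_ + _); field; rewrite !gt_eqF//; lra.
rewrite uE; case: eqVneq => [->|j0].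
  by rewrite addn0 lerDl mulr_ge0// step_prob_ge0.
rewrite add0r mulrC ler_wpM2r ?step_prob_ge0//.
rewrite /low_weight; case: ifP => // bjB.
have b0 : (0 < b)%N by case/andP: s.
rewrite ifN; last by move: b0 j0; case: (b) => // b' _; case: (j) => // j' _;
  rewrite addSn addnS.
rewrite mulr1 /E ler_weXn2l// leq_sub2l// -addn1 leq_add2l lt0n//.
Qed.

Lemma natpow_le_max t B b : (0 < b)%N -> (b <= B)%N ->
  natpow t b <= expR (`|t| * ln B%:R).
Proof.
move=> b0 bB; have B0 : (0 < B)%N by exact: leq_trans bB.
rewrite ler_expR (@le_trans _ _ (`|t| * ln b%:R))//.
  by rewrite ler_wpM2r ?ler_norm// ln_ge0 ?ler1n.
by rewrite ler_wpM2l// ler_ln ?ler_nat// posrE ltr0n.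
Qed.

(** Above a level B the power k^t is multiplied by at most l, because
    l > 1 / (1 - t); below B the bounded excess is absorbed by low_weight, which
    is multiplied by at most g^2 < l up to a term that is D times smaller. *)
Lemma moment_upper t (l : R) : t < 1 -> 1 / (1 - t) < l -> g ^+ 2 < l ->
  exists2 C, 0 < C & forall n r, 0 <= r <= 1 ->
    (iter n transfer (fun k _ => (natpow t k)%:E) 1%N r <= (C * l ^+ n)%:E)%E.
Proof.
move=> t1 lt lg; have s0 : 0 < 1 - t by lra.
have l0 : 0 < l by apply: lt_trans lt; rewrite divr_gt0.
have ls : 1 < l * (1 - t) by rewrite -ltr_pdivrMr.
have lnls := ln_gt0 ls.
have [B B1 HB] : exists2 B, (1 < B)%N & forall b, (B <= b)%N ->
    expR ((2 - t) / b%:R) / (1 - t) <= l.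
  exists (Num.truncn ((2 - t) / ln (l * (1 - t)))).+2 => // b Bb.
  have b0 : 0 < b%:R :> R by rewrite ltr0n (leq_trans _ Bb).
  rewrite ler_pdivrMr// -[leRHS]lnK ?posrE ?ler_expR; last lra.
  rewrite ler_pdivrMr// mulrC -ler_pdivrMr//.
  apply: ltW; apply: lt_le_trans (truncnS_gt _) _.
  by rewrite ler_nat; exact: leq_trans Bb.
have [M M0 ME] : exists2 M, 0 <= M &
    M = expR (2 - t) / (1 - t) * expR (`|t| * ln B%:R).
  eexists; last reflexivity.
  by rewrite mulr_ge0 ?divr_ge0 ?expR_ge0//; lra.
have [D D1 DM] : exists2 D, 1 <= D & M + 1 <= (l - g ^+ 2) * D.
  exists (1 + (M + 1) / (l - g ^+ 2)).
    by rewrite lerDl divr_ge0//; lra.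
  by rewrite mulrDr mulr1 mulrCA divff ?mulr1 ?gt_eqF//; lra.
pose W b r := natpow t b + low_weight B D b r.
have V0 b r : state b r -> 0 <= low_weight B D b r.
  by move=> s; apply: low_weight_ge0 => //; lra.
have W0 b r : state b r -> 0 <= W b r.
  by move=> s; rewrite addr_ge0 ?natpow_ge0// V0.
have KW b r : state b r -> (transfer (fun b r => (W b r)%:E) b r <= (l * W b
  r)%:E)%E.
  move=> s; have b0 : (0 < b)%N by case/andP: s.
  have -> : transfer (fun b r => (W b r)%:E) b r =
    (transfer (fun k _ => (natpow t k)%:E) b r +
     transfer (fun b r => (low_weight B D b r)%:E) b r)%E.
    by rewrite -transferD// => b' r' s'; rewrite lee_fin ?natpow_ge0 ?V0.
  have hp := transfer_natpow_le t1 s.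
  have [Bb|bB] := leqP B b.
    rewrite transfer_low_weight0// adde0; apply: (le_trans hp).
    rewrite lee_fin; apply: (@le_trans _ _ (l * natpow t b)).
      by rewrite ler_wpM2r ?natpow_ge0// HB.
    by rewrite ler_wpM2l ?(ltW l0)// lerDl V0.
  apply: (le_trans (leeD hp (transfer_low_weight_le D1 s bB))).
  rewrite -EFinD lee_fin.
  have hM : expR ((2 - t) / b%:R) / (1 - t) * natpow t b <= M.
    rewrite ME ler_pM ?natpow_ge0 ?natpow_le_max ?(ltnW bB)//.
      by rewrite divr_ge0 ?expR_ge0//; lra.
    rewrite ler_pM2r ?invr_gt0// ler_expR ler_pdivrMr; last exact: state_gt0 s.
    by rewrite ler_peMr ?(state_ge1 s)//; lra.
  have E1 : 1 <= D ^+ (B - b.+1) by rewrite exprn_ege1.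
  have VE : D * D ^+ (B - b.+1) <= low_weight B D b r.
    rewrite /low_weight bB -exprS -subSn// subSS ler_peMr ?exprn_ge0 ?(le_trans
      ler01)//.
    case: ifP => // _; have /andP[h _] := stay_weight_bounds (state_r s).
    by move: (stay_weight r) h => w h; lra.
  set E := D ^+ _ in E1 VE *; set V := low_weight _ _ _ _ in VE *.
  have h1 : M + E <= (M + 1) * E by nra.
  have h2 : (M + 1) * E <= (l - g ^+ 2) * D * E by rewrite ler_wpM2r//; lra.
  have h3 : (l - g ^+ 2) * D * E <= (l - g ^+ 2) * V.
    by rewrite -mulrA ler_wpM2l//; lra.
  have h4 : 0 <= l * natpow t b by rewrite mulr_ge0 ?natpow_ge0// ltW.
  rewrite /W -/V mulrDr; lra.
exists (1 + D ^+ (B - 1) * 8).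
  by apply: ltr_pwDl => //; rewrite mulr_ge0// exprn_ge0//; lra.
move=> n r r01; have s : state 1 r by rewrite /state.
apply: (@le_trans _ _ (iter n transfer (fun b r => (W b r)%:E) 1%N r)).
  apply: le_iter_transfer => // b' r' s'; first by rewrite lee_fin natpow_ge0.
  by rewrite lee_fin lerDl V0.
apply: le_trans (iter_transfer_le n (ltW l0) W0 KW s) _.
rewrite lee_fin mulrC ler_wpM2r ?exprn_ge0 ?(ltW l0)// /W natpow1 lerD2l.
rewrite /low_weight B1 eqxx ler_wpM2l ?exprn_ge0//; first lra.
by have /andP[_ h] := stay_weight_bounds r01; lra.
Qed.

End upper_moment.

Section lower_moment.
Context {R : realType}.
Implicit Types (t r l : R) (b k n : nat).

Lemma transfer_ge_term (f : nat -> R -> \bar R) b r j :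
  (forall b r, state b r -> 0 <= f b r)%E -> state b r ->
  ((step_prob b r (b + j))%:E * f (b + j)%N (next_r (b + j) r) <= transfer f b r)%E.
Proof.
move=> f0 s; have h i : (0 <= (step_prob b r (b + i))%:E * f (b + i)%N (next_r (b
  + i) r))%E.
  by rewrite mule_ge0 ?lee_fin ?step_prob_ge0// f0// state_next// state_addr.
apply: (@le_trans _ _ (\sum_(0 <= i < j.+1) (step_prob b r (b + i))%:E * f (b +
  i)%N (next_r (b + i) r))%E).
  by rewrite big_nat_recr//= leeDr// sume_ge0.
by apply: nneseries_lim_ge => i _ _.
Qed.

(** Restricted to the levels above some B, the power k^t is multiplied by at
    least l; the first step reaches the level B with a probability bounded
    below uniformly in r. *)
Lemma moment_lower t l : t < 1 -> 0 < l -> l < 1 / (1 - t) ->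
  exists2 c, 0 < c & forall n r, (0 < n)%N -> 0 <= r <= 1 ->
    ((c * l ^+ n)%:E <= iter n transfer (fun k _ => (natpow t k)%:E) 1%N r)%E.
Proof.
move=> t1 l0 lt; have s0 : 0 < 1 - t by lra.
have ls : l * (1 - t) < 1 by rewrite -ltr_pdivlMr.
have ls0 : 0 < l * (1 - t) by rewrite mulr_gt0.
have lnls : 0 < - ln (l * (1 - t)) by rewrite oppr_gt0 ln_lt0// ls0.
pose B := (Num.truncn (3 / - ln (l * (1 - t)))).+1.
have HB b : (B <= b)%N -> l <= expR (- (3 / b%:R)) / (1 - t).
  move=> Bb; have b0 : 0 < b%:R :> R by rewrite ltr0n (leq_trans _ Bb).
  rewrite ler_pdivlMr// -[leLHS]lnK ?posrE ?ler_expR// lerNr.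
  rewrite ler_pdivrMr// mulrC -ler_pdivrMr//.
  apply: (@le_trans _ _ B%:R); last by rewrite ler_nat.
  by apply: ltW; exact: truncnS_gt.
pose W b r := if (B <= b)%N then natpow t b else 0.
have W0 b r : state b r -> 0 <= W b r.
  by move=> s; rewrite /W; case: ifP; rewrite ?natpow_ge0.
have KW b r : state b r -> ((l * W b r)%:E <= transfer (fun b r => (W b r)%:E) b
  r)%E.
  move=> s; rewrite {1}/W; case: ifP => [Bb|_]; last first.
    by rewrite mulr0; apply: transfer_ge0.
  have -> : transfer (fun b r => (W b r)%:E) b r =
      transfer (fun k _ => (natpow t k)%:E) b r.
    by apply: eq_eseriesr => j _; rewrite /W (leq_trans Bb)// leq_addr.
  apply: le_trans (transfer_natpow_ge t1 s).
  by rewrite lee_fin ler_wpM2r ?natpow_ge0// HB.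
pose p := 1 / ((B%:R + 1) * (B%:R + 2)) : R.
have p0 : 0 < p by rewrite divr_gt0// mulr_gt0.
exists (p * natpow t B / l).
  by rewrite divr_gt0// mulr_gt0 ?natpow_gt0.
case=> // n r _ r01; have s : state 1 r by rewrite /state.
apply: (@le_trans _ _ (iter n.+1 transfer (fun b r => (W b r)%:E) 1%N r)); last
  first.
  apply: le_iter_transfer => // b' r' s'.
  by rewrite lee_fin /W; case: ifP => // _; rewrite natpow_ge0.
rewrite /=; apply: le_trans (@transfer_ge_term _ _ _ B.-1 _ s); last first.
  by apply: iter_transfer_ge0 => b' r' s'; rewrite lee_fin W0.
have -> : (1 + B.-1)%N = B by [].
have sB : state B (next_r B r) by exact/state_next/(state_addr B.-1 s).
apply: (@le_trans _ _ ((step_prob 1 r B)%:E * (l ^+ n * W B (next_r B r))%:E)%E);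
  last first.
  by rewrite lee_wpmul2l ?lee_fin ?step_prob_ge0// iter_transfer_ge// ltW.
rewrite -EFinM lee_fin /W leqnn.
have -> : p * natpow t B / l * l ^+ n.+1 = p * (l ^+ n * natpow t B).
  by rewrite exprS; field; rewrite gt_eqF.
rewrite ler_wpM2r ?mulr_ge0 ?natpow_ge0 ?exprn_ge0 ?(ltW l0)//.
have -> : p = 1%:R / (B.+1%:R * B.+2%:R).
  by rewrite /p -[B.+2%:R]natr1 -[B.+1%:R]natr1 -addrA.
exact: step_prob_ge.
Qed.

End lower_moment.

(** * Tail estimates *)

Section tails.
Context {R : realType}.
Implicit Types (t r x y z a : R) (b k n : nat).
Local Notation g := (@golden R).

Definition event (A : set nat) k (r : R) : \bar R := (\1_A k)%:E.

Lemma event_ge0 A k r : (0 <= event A k r)%E.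
Proof. by rewrite lee_fin indicE. Qed.

Lemma le_event A B k r : A `<=` B -> (event A k r <= event B k r)%E.
Proof.
move=> AB; rewrite lee_fin !indicE ler_nat.
by case: (boolP (k \in A)) => // /set_mem/AB/mem_set ->.
Qed.

(** In the applications f is the indicator of a tail, or a moment of another
    order cut off to a tail, and a is the exponential rate at which the
    multiple of k^t dominating it varies with n. *)
Lemma transfer_chernoff t L : t < 1 -> 1 / (1 - t) < expR L -> g ^+ 2 < expR L ->
  exists2 C, 0 < C & forall n a (f : nat -> R -> R) r, 0 <= r <= 1 ->
    (forall k r, (0 < k)%N -> 0 <= f k r <= expR (n%:R * a) * natpow t k) ->
    (iter n transfer (fun k r => (f k r)%:E) 1%N r <= (C * expR (n%:R * (a +
      L)))%:E)%E.
Proof.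
move=> t1 tL gL; have [C C0 HC] := moment_upper t1 tL gL.
exists C => // n a f r r01 Hf; have s : state 1 r by rewrite /state.
have state0 b r' : state b r' -> (0 < b)%N by case/andP.
apply: (@le_trans _ _ (iter n transfer (fun k _ => (expR (n%:R * a))%:E * (natpow
  t k)%:E)%E 1%N r)).
  apply: le_iter_transfer => // b r' s'; have := Hf b r' (state0 _ _ s').
    by rewrite lee_fin => /andP[].
  by rewrite -EFinM lee_fin => /andP[].
rewrite iter_transferZ//; last by move=> *; rewrite lee_fin natpow_ge0.
rewrite mulrDr expRD [expR (n%:R * L)]expRM_natl mulrCA EFinM.
by rewrite lee_wpmul2l ?lee_fin ?expR_ge0// HC.
Qed.

Lemma event_le_natpow (A : set nat) t a k n : (A k -> 0 <= n%:R * a + t * ln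
  k%:R) ->
  \1_A k <= expR (n%:R * a) * natpow t k.
Proof.
move=> h; rewrite indicE /natpow -expRD; case: (boolP (k \in A)) => [/set_mem/h
  kA|_].
  by rewrite -[leLHS](@expR0 R) ler_expR.
by rewrite expR_ge0.
Qed.

Definition log_ge y n : set nat := [set k | y * n%:R <= ln k%:R].

Definition log_le y n : set nat := [set k | ln k%:R <= y * n%:R].

(** Exponential Chebyshev inequality with the optimal exponent
    t = x / (1 + x), for which 1 / (1 - t) = 1 + x. *)
Lemma right_tail x c : 0 < x -> c < x - ln (x + 1) ->
  exists2 C, 0 < C & forall n r, 0 <= r <= 1 ->
  (iter n transfer (event (log_ge (1 + x) n)) 1%N r <=
   (C * expR (- c * n%:R))%:E)%E.
Proof.
move=> x0 cx; pose t := x / (1 + x); pose L := x - c.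
have x1 : 0 < 1 + x by lra.
have t1E : 1 / (1 - t) = 1 + x by rewrite /t; field; rewrite !gt_eqF//; lra.
have t1 : t < 1 by rewrite /t ltr_pdivrMr; lra.
have xL : 1 + x < expR L.
  by rewrite -[ltLHS]lnK ?posrE// ltr_expR /L addrC; lra.
have [||C C0 HC] := transfer_chernoff t1 (L := L).
- by rewrite t1E.
- by rewrite golden_sqr; have := @golden_gt0 R; lra.
exists C => // n r r01.
have -> : - c * n%:R = n%:R * (- x + L) by rewrite /L; ring.
apply: HC => // k _ k0; rewrite indicE ler0n -indicE/=; apply: event_le_natpow =>
  /= h.
have -> : n%:R * - x + t * ln k%:R = t * (ln k%:R - (1 + x) * n%:R).
  by rewrite /t; field; rewrite gt_eqF//; lra.
by rewrite mulr_ge0 ?subr_ge0// divr_ge0// ltW.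
Qed.

(** The affine branch of the rate function, with (sqrt 5 + 1) / 2 = 1 + g. *)
Definition rate_below x : R := - (1 + g) * (x + 1) + 2 * ln (1 + g).

Lemma golden_inv : g^-1 = 1 + g.
Proof.
have g0 := @golden_gt0 R; apply: (@mulIf _ g); first by rewrite gt_eqF.
by rewrite mulVf ?gt_eqF// mulrDl mul1r -expr2 golden_sqr; ring.
Qed.

Lemma ln_1golden : ln (1 + g) = - ln g.
Proof. by rewrite -golden_inv lnV// posrE golden_gt0. Qed.

(** The optimal exponent x / (1 + x) can be used as long as 1 / (1 - t) = 1 + x
    exceeds g^2, that is for x > - g. Further to the left, remaining at the
    quotient 1 dominates all moments, and the bound is the one given by the
    extreme exponent - (1 + g), for which 1 / (1 - t) = g^2. *)
Lemma left_tail x c : -1 <= x < 0 ->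
  c < (if - g < x then x - ln (x + 1) else rate_below x) ->
  exists2 C, 0 < C & forall n r, 0 <= r <= 1 ->
  (iter n transfer (event (log_le (1 + x) n)) 1%N r <=
   (C * expR (- c * n%:R))%:E)%E.
Proof.
move=> /andP[x1 x0]; have g0 := @golden_gt0 R; have g2 := @golden_sqr R.
case: ifPn; rewrite -?leNgt => gx cx.
- pose t := x / (1 + x); pose L := x - c.
  have /andP[_ g1] := @golden_bounds R.
  have x10 : 0 < 1 + x by lra.
  have t1E : 1 / (1 - t) = 1 + x by rewrite /t; field; rewrite !gt_eqF//; lra.
  have t1 : t < 1 by rewrite /t ltr_pdivrMr; lra.
  have xL : 1 + x < expR L.
    by rewrite -[ltLHS]lnK ?posrE// ltr_expR /L addrC; lra.
  have [||C C0 HC] := transfer_chernoff t1 (L := L).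
  + by rewrite t1E.
  + by rewrite golden_sqr; lra.
  exists C => // n r r01.
  have -> : - c * n%:R = n%:R * (- x + L) by rewrite /L; ring.
  apply: HC => // k _ k0; rewrite indicE ler0n -indicE/=; apply: event_le_natpow
    => /= h.
  have -> : n%:R * - x + t * ln k%:R = (- t) * ((1 + x) * n%:R - ln k%:R).
    by rewrite /t; field; rewrite gt_eqF//; lra.
  by rewrite mulr_ge0 ?subr_ge0// /t -mulNr divr_ge0//; lra.
- pose t := - (1 + g); pose L := - (1 + g) * (x + 1) - c.
  have t1E : 1 / (1 - t) = g ^+ 2.
    rewrite /t; apply: (@mulIf _ (2 + g)); first by rewrite gt_eqF//; lra.
    rewrite [X in X * _ = _](_ : _ = (2 + g)^-1); last by rewrite div1r; congr
      (_^-1); ring.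
    rewrite mulVf; last by rewrite gt_eqF//; lra.
    have -> : g ^+ 2 * (2 + g) = g ^+ 2 + g ^+ 2 + g * g ^+ 2 by ring.
    by rewrite g2 mulrBr -expr2 g2; ring.
  have xL : g ^+ 2 < expR L.
    rewrite -[ltLHS]lnK ?posrE ?exprn_gt0// ltr_expR lnXn//.
    by move: cx; rewrite /rate_below ln_1golden /L; lra.
  have [|||C C0 HC] := @transfer_chernoff t L.
  + by rewrite /t; lra.
  + by rewrite t1E.
  + by [].
  exists C => // n r r01.
  have -> : - c * n%:R = n%:R * (((1 + g) * (x + 1)) + L) by rewrite /L; ring.
  apply: HC => // k _ k0; rewrite indicE ler0n -indicE/=; apply: event_le_natpow
    => /= h.
  have -> : n%:R * ((1 + g) * (x + 1)) + t * ln k%:R = (1 + g) * ((1 + x) * n%:R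
    - ln k%:R).
    by rewrite /t; ring.
  by rewrite mulr_ge0 ?subr_ge0//; lra.
Qed.

End tails.

(** * Lower bounds by tilting and by waiting *)

Section window.
Context {R : realType}.
Implicit Types (t r x y z a e : R) (b k n m : nat).
Local Notation g := (@golden R).

Definition window z e n : set nat := [set k | `|ln k%:R - z * n%:R| <= e * n%:R
  :> R].

Lemma expR_small d (K : R) : 0 < d -> exists N, forall n, (N <= n)%N -> K * expR
  (- d * n%:R) <= 1.
Proof.
move=> d0; exists (Num.truncn (K / d)).+1 => n Nn.
rewrite mulNr expRN ler_pdivrMr ?expR_gt0// mul1r.
apply: le_trans (expR_ge1Dx _); apply: ler_wpDl => //.
rewrite -ler_pdivrMl// mulrC; apply: (@le_trans _ _ (Num.truncn (K / d)).+1%:R).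
  by apply: ltW; exact: truncnS_gt.
by rewrite ler_nat.
Qed.

(** Tilting: for t = 1 - 1/z the function u |-> - ln (1 - u) has derivative z at
    t, so the n-th moment of order t is carried by the k with ln k close to z n.
    Indeed, above the window k^t is at most exp (- n h (z + e)) k^(t + h), and
    the growth factor z of the moment of order t only becomes z / (1 - h z),
    that is z exp (h z + O(h^2)), for the order t + h; the product is smaller
    than z^n by an exponential factor when h is small. The same holds below the
    window with h and e replaced by their opposites. The moment of order t - h
    has the required growth rate because z > g^2 leaves room for a small h. *)
Lemma window_lower_small z e d : g ^+ 2 < z -> 0 < e -> 0 < d ->
  exists2 c, 0 < c & exists N, forall n r, (N <= n)%N -> 0 <= r <= 1 ->
  ((c * expR (- (z - 1 - ln z + d + `|1 - z^-1| * e) * n%:R))%:E <=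
   iter n transfer (event (window z e n)) 1%N r)%E.
Proof.
move=> gz e0 d0.
have g0 := @golden_gt0 R.
have g20 : 0 < g ^+ 2 by rewrite exprn_gt0.
have z0 : 0 < z by lra.
(* h z^2 bounds the second order terms; it must be small compared with e, and
   with z - g^2 so that the order t - h stays admissible. *)
have [h [h0 hz hze hzg]] : exists h, [/\ 0 < h, h * z <= 1 / 2, 4 * (h * z * z)
  <= e & h * z * z < z - g ^+ 2].
  have [m [m0 m1 m2 m3]] : exists m : R, [/\ 0 < m, m <= 2 * z, m <= e & m <= z -
    g ^+ 2].
    exists (Num.min (2 * z) (Num.min e (z - g ^+ 2))).
    by rewrite !lt_min !ge_min !lexx !orbT e0 subr_gt0 gz mulr_gt0.
  exists (m / (4 * z * z)).
  have -> : m / (4 * z * z) * z = m / (4 * z) by field; rewrite gt_eqF.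
  have -> : m / (4 * z) * z = m / 4 by field; rewrite gt_eqF.
  split; [by rewrite divr_gt0// !mulr_gt0| |lra|lra].
  by rewrite ler_pdivrMr ?mulr_gt0//; lra.
have [d' [d'0 d'd d'h]] : exists d', [/\ 0 < d', d' <= d & 6 * d' <= h * e].
  exists (Num.min d (h * e / 6)).
  have he : 0 < h * e by rewrite mulr_gt0.
  rewrite lt_min d0 divr_gt0//; split => //; first by rewrite ge_min lexx.
  rewrite mulrC -ler_pdivlMr// ge_min lexx orbT//.
pose t := 1 - z^-1.
have hzl : 0 < h * z by rewrite mulr_gt0.
have tE : 1 / (1 - t) = z by rewrite /t opprB addrC subrK div1r invrK.
have t1 : t < 1 by rewrite /t gtrBl invr_gt0.
have thE : 1 / (1 - (t + h)) = z / (1 - h * z).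
  by rewrite /t; field; rewrite !gt_eqF//; lra.
have tmE : 1 / (1 - (t - h)) = z / (1 + h * z).
  by rewrite /t; field; rewrite !gt_eqF//; lra.
have hzi : h < z^-1 by rewrite -[z^-1]mul1r ltr_pdivlMr//; lra.
have th1 : t + h < 1 by rewrite /t; lra.
have tm1 : t - h < 1 by lra.
have u1 : 0 < 1 - h * z by lra.
have u2 : 0 < 1 + h * z by lra.
have [c1 c10 H1] : exists2 c, 0 < c & forall n r, (0 < n)%N -> 0 <= r <= 1 ->
    ((c * expR (ln z - d') ^+ n)%:E <= iter n transfer (fun k _ => (natpow t
      k)%:E) 1%N r)%E.
  apply: moment_lower => //; first exact: expR_gt0.
  by rewrite tE -[ltRHS]lnK ?posrE// ltr_expR; lra.
have Lp : ln z - ln (1 - h * z) + d' - h * (z + e) <= ln z - 2 * d'.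
  have := @le_lnB1 R (1 - h * z)^-1; rewrite invr_gt0 u1 lnV// => /(_ isT) hl.
  have : (1 - h * z)^-1 - 1 <= h * z + 2 * (h * z * (h * z)).
    have -> : (1 - h * z)^-1 - 1 = h * z / (1 - h * z) by field; rewrite gt_eqF.
    rewrite ler_pdivrMr//; move: (h * z) hzl hz => w w0 w1.
    have : 0 <= w * w * (1 - 2 * w).
      by apply: mulr_ge0; [apply: mulr_ge0; exact: ltW|lra].
    by lra.
  have : 2 * (h * z * (h * z)) <= h * e / 2.
    by have := ler_wpM2l (ltW h0) hze; lra.
  by lra.
have Lm : ln z - ln (1 + h * z) + d' + h * (z - e) <= ln z - 2 * d'.
  have := @le_lnB1 R (1 + h * z)^-1; rewrite invr_gt0 u2 lnV// => /(_ isT) hl.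
  have : (1 + h * z)^-1 - 1 <= - (h * z) + h * z * (h * z).
    have -> : (1 + h * z)^-1 - 1 = - (h * z) / (1 + h * z) by field; rewrite gt_eqF.
    rewrite ler_pdivrMr//; move: (h * z) hzl => w w0.
    have : 0 <= w * w * w by rewrite !mulr_ge0// ltW.
    by lra.
  have : h * z * (h * z) <= h * e / 4.
    by have := ler_wpM2l (ltW h0) hze; lra.
  by lra.
have zp : z < z / (1 - h * z) by rewrite ltr_pdivlMr//; nra.
have zm : g ^+ 2 < z / (1 + h * z) by rewrite ltr_pdivlMr//; nra.
have expE w : 0 < w -> w < expR (ln w + d').
  by move=> w0; rewrite -[ltLHS]lnK ?posrE// ltr_expR; lra.
have ep := expE _ (lt_trans z0 zp).
have em := expE _ (lt_trans g20 zm).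
have [||C2 C20 H2] := @transfer_chernoff _ (t + h) (ln (z / (1 - h * z)) + d') th1.
- by rewrite thE.
- by lra.
have [||C3 C30 H3] := @transfer_chernoff _ (t - h) (ln (z / (1 + h * z)) + d') tm1.
- by rewrite tmE.
- by lra.
rewrite ln_div ?posrE// in H2; rewrite ln_div ?posrE// in H3.
have [N HN] := @expR_small d' ((C2 + C3) * (2 / c1)) d'0.
exists (c1 / 2); first by rewrite divr_gt0.
exists N.+1 => n r Nn r01; have s : state 1 r by rewrite /state.
have n0 : (0 < n)%N by exact: leq_trans Nn.
pose f2 k r := if (z + e) * n%:R < ln k%:R then natpow t k else 0 : R.
pose f3 k r := if ln k%:R < (z - e) * n%:R then natpow t k else 0 : R.
have f20 k r' : 0 <= f2 k r' by rewrite /f2; case: ifP => // _; exact: natpow_ge0.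
have f30 k r' : 0 <= f3 k r' by rewrite /f3; case: ifP => // _; exact: natpow_ge0.
have F2 : (iter n transfer (fun k r => (f2 k r)%:E) 1%N r <= (C2 * expR (n%:R *
  (ln z - 2 * d')))%:E)%E.
  apply: le_trans (H2 n (- (h * (z + e))) _ r r01 _) _; last first.
    by rewrite lee_fin ler_pM2l// ler_expR ler_wpM2l//; lra.
  move=> k r' k0; rewrite f20/= /f2 /natpow -expRD; case: ifP => [hk|_]; last
    exact: expR_ge0.
  rewrite ler_expR; have := ler_wpM2l (ltW h0) (ltW hk); lra.
have F3 : (iter n transfer (fun k r => (f3 k r)%:E) 1%N r <= (C3 * expR (n%:R *
  (ln z - 2 * d')))%:E)%E.
  apply: le_trans (H3 n (h * (z - e)) _ r r01 _) _; last first.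
    by rewrite lee_fin ler_pM2l// ler_expR ler_wpM2l//; lra.
  move=> k r' k0; rewrite f30/= /f3 /natpow -expRD; case: ifP => [hk|_]; last
    exact: expR_ge0.
  rewrite ler_expR; have := ler_wpM2l (ltW h0) (ltW hk); lra.
set E := expR (n%:R * (t * z + `|t| * e)).
have decomp : (iter n transfer (fun k _ => (natpow t k)%:E) 1%N r <=
   E%:E * iter n transfer (event (window z e n)) 1%N r +
   (iter n transfer (fun k r => (f2 k r)%:E) 1%N r + iter n transfer (fun k r =>
     (f3 k r)%:E) 1%N r))%E.
  rewrite -iter_transferZ//; last by move=> *; exact: event_ge0.
  rewrite -iter_transferD//; [|by move=> *; rewrite lee_fin..].
  rewrite -iter_transferD//; last 2 first.
  - by move=> *; rewrite mule_ge0 ?event_ge0// lee_fin expR_ge0.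
  - by move=> *; rewrite -EFinD lee_fin addr_ge0.
  apply: le_iter_transfer => // b r' s'; first by rewrite lee_fin natpow_ge0.
  suff : natpow t b <= E * \1_(window z e n) b + (f2 b r' + f3 b r') by [].
  rewrite indicE.
  case: (boolP (b \in window z e n)) => [/set_mem/= hw|hw].
    rewrite mulr1; apply: ler_wpDr; first exact: addr_ge0.
    rewrite /E ler_expR.
    have -> : t * ln b%:R = n%:R * (t * z) + t * (ln b%:R - z * n%:R) by ring.
    rewrite [X in _ <= X]mulrDr lerD2l; apply: le_trans (ler_norm _) _.
    by rewrite normrM mulrCA ler_wpM2l// [X in _ <= X]mulrC.
  rewrite mulr0 add0r.
  have : e * n%:R < `|ln b%:R - z * n%:R|.
    by rewrite ltNge; apply: contra hw => hw; apply: mem_set.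
  rewrite lter_normr => /orP[hb|hb].
    by apply: ler_wpDr => //; rewrite /f2 ifT//; lra.
  by apply: ler_wpDl => //; rewrite /f3 ifT//; lra.
have {decomp}F : ((c1 * expR (ln z - d') ^+ n)%:E <= E%:E * iter n transfer
  (event (window z e n)) 1%N r +
   ((C2 + C3) * expR (n%:R * (ln z - 2 * d')))%:E)%E.
  apply: le_trans (H1 _ _ n0 r01) _; apply: (le_trans decomp).
  by rewrite leeD2l// mulrDl EFinD leeD.
have X0 : (0 <= iter n transfer (event (window z e n)) 1%N r)%E.
  by apply: iter_transfer_ge0 s => b r' _; rewrite event_ge0.
move: F X0; case: (iter n transfer _ _ _) => [X| |]//; last by move=> _ _; exact:
  leey.
rewrite -EFinM -EFinD !lee_fin => F X0.
have HN' := HN n (ltnW Nn).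
have h1 : (C2 + C3) * expR (n%:R * (ln z - 2 * d')) <= c1 / 2 * expR (ln z - d')
  ^+ n.
  have -> : (C2 + C3) * expR (n%:R * (ln z - 2 * d')) =
     c1 / 2 * expR (ln z - d') ^+ n * ((C2 + C3) * (2 / c1) * expR (- d' * n%:R)).
    have -> : n%:R * (ln z - 2 * d') = n%:R * (ln z - d') + (- d' * n%:R) by ring.
    by rewrite -expRM_natl expRD; field; rewrite gt_eqF.
  by rewrite ler_piMr// mulr_ge0 ?exprn_ge0 ?expR_ge0// divr_ge0 ?ltW.
have h2 : c1 / 2 * expR (ln z - d') ^+ n <= E * X by lra.
apply: (@le_trans _ _ (c1 / 2 * expR (ln z - d') ^+ n / E)); last first.
  by rewrite ler_pdivrMr; [rewrite [X in _ <= X]mulrC|exact: expR_gt0].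
rewrite -[X in _ <= X]mulrA ler_pM2l ?divr_gt0// -expRM_natl /E -expRN -expRD
  ler_expR.
have -> : t * z = z - 1 by rewrite /t; field; rewrite gt_eqF.
rewrite -/t.
have := ler_wpM2r (ler0n R n) d'd; lra.
Qed.

End window.

Section lower_bound.
Context {R : realType}.
Implicit Types (t r x y z a e d : R) (b k n m : nat).
Local Notation g := (@golden R).

Lemma window_lower z e d : g ^+ 2 < z -> 0 < e -> 0 < d ->
  exists2 c, 0 < c & exists N, forall n r, (N <= n)%N -> 0 <= r <= 1 ->
  ((c * expR (- (z - 1 - ln z + d) * n%:R))%:E <=
   iter n transfer (event (window z e n)) 1%N r)%E.
Proof.
move=> gz e0 d0.
have [a [a0 aE]] : exists a, 0 < a /\ a = `|1 - z^-1| + 1.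
  by exists (`|1 - z^-1| + 1); split => //; rewrite ltr_wpDl.
have [e' [e'0 e'e e'd]] : exists e', [/\ 0 < e', e' <= e & a * e' <= d / 2].
  exists (Num.min e (d / 2 / a)); rewrite lt_min e0 !divr_gt0//; split => //.
    by rewrite ge_min lexx.
  by rewrite mulrC -ler_pdivlMr// ge_min lexx orbT.
have d20 : 0 < d / 2 by rewrite divr_gt0.
have [c c0 [N HN]] := window_lower_small gz e'0 d20.
exists c => //; exists N => n r Nn r01; have s : state 1 r by rewrite /state.
apply: le_trans (le_trans (HN n r Nn r01) _).
  rewrite lee_fin ler_pM2l// ler_expR ler_wpM2r// lerN2 -addrA lerD2l.
  move: e'd; rewrite aE mulrDl mul1r; lra.
apply: le_iter_transfer => // b r' s'; first exact: event_ge0.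
apply: le_event => k; rewrite /window/= => /le_trans; apply.
by rewrite ler_wpM2r.
Qed.

(** The chain repeats the quotient 1 for m steps, which the eigenfunction
    stay_weight prices at (g^2)^m; its bounds 1/4 and 2 give the constant 8. *)
Lemma stay_then n (f : nat -> R -> \bar R) a : 0 <= a ->
  (forall b r, state b r -> 0 <= f b r)%E ->
  (forall r, 0 <= r <= 1 -> (a%:E <= iter n transfer f 1%N r)%E) ->
  forall m r, 0 <= r <= 1 ->
  ((a / 8 * (g ^+ 2) ^+ m)%:E <= iter (m + n) transfer f 1%N r)%E.
Proof.
move=> a0 f0 fa m.
have g20 : 0 <= g ^+ 2 by rewrite exprn_ge0// ltW// golden_gt0.
suff H r : 0 <= r <= 1 ->
    ((a / 2 * (g ^+ 2) ^+ m * stay_weight r)%:E <= iter (m + n) transfer f 1%N r)%E.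
  move=> r r01; apply: le_trans (H _ r01); rewrite lee_fin.
  have /andP[h _] := stay_weight_bounds r01.
  have : 0 <= a / 2 * (g ^+ 2) ^+ m.
    by apply: mulr_ge0; [rewrite divr_ge0|exact: exprn_ge0].
  by move/(ler_wpM2l)/(_ _ _ h); lra.
elim: m r => [|m ih] r r01.
  apply: le_trans (fa _ r01); rewrite lee_fin mulr1.
  by have /andP[_ h] := stay_weight_bounds r01; have := ler_wpM2l a0 h; lra.
have s : state 1 r by rewrite /state.
have r01' := state_r (state_next s).
rewrite addSn/=; apply: le_trans (@transfer_ge_term _ _ _ _ 0 _ s); last first.
  exact: iter_transfer_ge0.
rewrite addn0; apply: (@le_trans _ _ ((step_prob 1 r 1)%:E * (a / 2 * (g ^+ 2) ^+
  m * stay_weight (next_r 1 r))%:E)%E).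
  rewrite -EFinM lee_fin [X in _ <= X]mulrCA stay_weightE// exprS.
  by rewrite le_eqVlt; apply/orP; left; apply/eqP; ring.
by rewrite lee_wpmul2l ?lee_fin ?step_prob_ge0// ih.
Qed.

Definition rate x : R := if - g < x then x - ln (x + 1) else rate_below x.

(** For 1 + x <= g^2 the tilt of [window_lower] is no longer available. The
    chain then repeats the quotient 1 during a proportion 1 - tau of the time,
    at the price - 2 ln g per step, and moves with a speed z slightly above g^2
    during the rest, where tau z is close to 1 + x. The cost is the
    interpolation between the values - 2 ln g at speed 0 and g^2 - 1 - 2 ln g at
    speed g^2, which is the affine branch of the rate. *)
Lemma window_lower_rate x e d : -1 <= x -> 0 < e -> 0 < d ->
  exists2 c, 0 < c & exists N, forall n, (N <= n)%N ->
  ((c * expR (- (rate x + d) * n%:R))%:E <=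
   iter n transfer (event (window (1 + x)%R e n)) 1%N 0%R)%E.
Proof.
move=> x1 e0 d0; have /andP[ga gb] := @golden_bounds R; have g2 := @golden_sqr R.
have r00 : 0 <= (0 : R) <= 1 by rewrite lexx ler01.
rewrite /rate; case: ifPn; rewrite -?leNgt => gx.
  have gz : g ^+ 2 < 1 + x by lra.
  have [c c0 [N HN]] := window_lower gz e0 d0.
  exists c => //; exists N => n Nn; have := HN n 0 Nn r00.
  by have -> : 1 + x - 1 - ln (1 + x) = x - ln (x + 1) by rewrite [1 + x]addrC;
    ring.
(* q measures both the excess of z over g^2 and the error in tau z = 1 + x. *)
have [q [q0 q1 qe qd]] : exists q, [/\ 0 < q, q <= 1, q <= e / 3 & q <= d / 4].
  exists (Num.min 1 (Num.min (e / 3) (d / 4))).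
  by rewrite !lt_min ltr01 !divr_gt0//= !ge_min !lexx !orbT.
have g0 : 0 < g by lra.
have [y [y0 yg yx]] : exists y, [/\ 0 <= y, y <= g ^+ 2 & y = 1 + x].
  by exists (1 + x); split => //; lra.
have g20 : 0 < g ^+ 2 by rewrite exprn_gt0.
have [tau [t0 t1 tE]] : exists tau, [/\ 0 < tau, tau <= 1 & tau * (1 + q) = y / g
  ^+ 2 + q].
  exists ((y / g ^+ 2 + q) / (1 + q)); split.
  - by rewrite divr_gt0 ?ltr_wpDl ?divr_ge0// ltW.
  - by rewrite ler_pdivrMr ?mul1r ?lerD2r ?ler_pdivrMr ?mul1r//; lra.
  - by rewrite divfK// gt_eqF//; lra.
have [z [zE gz]] : exists z, z = g ^+ 2 * (1 + q) /\ g ^+ 2 < z.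
  by exists (g ^+ 2 * (1 + q)); split => //; rewrite ltr_pMr//; lra.
have z0 : 0 < z by lra.
have ztau : z * tau = y + g ^+ 2 * q.
  by rewrite zE -mulrA [(1 + q) * _]mulrC tE mulrDr mulrCA divff ?mulr1// gt_eqF.
have e30 : 0 < e / 3 by rewrite divr_gt0.
have d40 : 0 < d / 4 by rewrite divr_gt0.
have [c c0 [N HN]] := window_lower gz e30 d40.
pose I := z - 1 - ln z + d / 4.
have lng : ln g < 0 by rewrite ln_lt0// g0; lra.
have I0 : 0 <= I by have := le_lnB1 z0; rewrite /I; lra.
have cost : (1 - tau) * (- (2 * ln g)) + tau * I <= rate_below x + d.
  have lnz : 2 * ln g <= ln z.
    rewrite zE lnM ?posrE//; last by rewrite addr_gt0.
    by rewrite lnXn// mulr_natl lerDl ln_ge0// lerDl ltW.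
  have h1 : I <= g ^+ 2 * q - g - 2 * ln g + d / 4 by rewrite /I; lra.
  have h2 := ler_wpM2l (ltW t0) h1.
  have yg1 : y * (1 + g) <= g.
    rewrite -golden_inv -ler_pdivlMr ?invr_gt0// invrK; apply: le_trans yg _.
    by rewrite expr2.
  have yg2 : y / g ^+ 2 * g = y * (1 + g).
    by rewrite -golden_inv; field; rewrite gt_eqF.
  have tq : tau * q <= q by rewrite ler_piMl// ltW.
  have h3 : y * (1 + g) - q <= tau * g.
    have : tau * g = y * (1 + g) + q * g - (tau * q) * g.
      by rewrite -yg2; have := congr1 (fun u => u * g) tE; lra.
    move=> ->.
    have : (tau * q) * g <= q * g by rewrite ler_wpM2r// ltW.
    by lra.
  have h4 : tau * (g ^+ 2 * q) <= q.
    apply: le_trans tq; rewrite ler_wpM2l ?(ltW t0)// ler_piMl ?(ltW q0)//; lra.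
  have h5 : tau * (d / 4) <= d / 4 by rewrite ler_piMl// ltW.
  by rewrite /rate_below ln_1golden; move: yg1 h2 h3; rewrite yx; lra.
(* The extra g^2 pays for the rounding of tau n to an integer. *)
exists (c / 8 * g ^+ 2); first by rewrite mulr_gt0// divr_gt0.
pose N1 := (Num.truncn (N.+1%:R / tau)).+1; pose N2 := (Num.truncn (3 * z / e)).+1.
exists (maxn N1 N2) => n; rewrite geq_max => /andP[N1n N2n].
have n0 : 0 <= n%:R :> R by [].
have N1n' : N.+1%:R <= tau * n%:R.
  rewrite mulrC -ler_pdivrMr//; apply: (@le_trans _ _ N1%:R); last by rewrite
    ler_nat.
  by apply: ltW; exact: truncnS_gt.
have N2n' : z <= e / 3 * n%:R.
  have : 3 * z / e <= n%:R.
    apply: (@le_trans _ _ N2%:R); last by rewrite ler_nat.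
    by apply: ltW; exact: truncnS_gt.
  by rewrite ler_pdivrMr//; lra.
have tn0 : 0 <= tau * n%:R by rewrite mulr_ge0// ltW.
have [n' [n'1 n'2]] : exists n', n'%:R <= tau * n%:R /\ tau * n%:R < n'%:R + 1.
  exists (Num.truncn (tau * n%:R)); have /andP[h1 h2] := truncn_itv tn0.
  by split => //; rewrite natr1.
have n'n : (n' <= n)%N.
  by rewrite -(ler_nat R); apply: (le_trans n'1); rewrite ler_piMl.
have Nn' : (N <= n')%N.
  rewrite -ltnS -(ltr_nat R) -natr1; apply: le_lt_trans n'2.
  by apply: le_trans N1n'; rewrite ler_nat.
have A0 : 0 <= c * expR (- I * n'%:R) by rewrite mulr_ge0 ?expR_ge0// ltW.
have ev0 b r : state b r -> (0 <= event (window z (e / 3) n') b r)%E.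
  by move=> _; exact: event_ge0.
have := @stay_then n' _ _ A0 ev0 (fun r => HN n' r Nn') (n - n') 0 r00.
rewrite subnK// => h.
apply: le_trans (le_trans h _); last first.
  apply: le_iter_transfer; [exact: ev0|move=> b r s'|by rewrite /state/= r00].
  apply: le_event => k; rewrite /window/= => hk.
  have -> : ln k%:R - (1 + x) * n%:R = (ln k%:R - z * n'%:R) + (z * n'%:R - y *
    n%:R).
    by rewrite yx; ring.
  apply: le_trans (ler_normD _ _) _.
  have h1 : e / 3 * n'%:R <= e / 3 * n%:R by rewrite ler_pM2l// ler_nat.
  have h2 : `|z * n'%:R - y * n%:R| <= z + e / 3 * n%:R.
    have -> : z * n'%:R - y * n%:R = z * (n'%:R - tau * n%:R) + g ^+ 2 * q * n%:R.
      have -> : y = z * tau - g ^+ 2 * q by rewrite ztau; ring.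
      by ring.
    apply: le_trans (ler_normD _ _) _; apply: lerD.
      rewrite normrM gtr0_norm// ler_piMr// ?(ltW z0)//.
      by rewrite ler_norml; lra.
    rewrite ger0_norm; last by apply: mulr_ge0 => //; apply: mulr_ge0; exact: ltW.
    rewrite ler_wpM2r//; apply: le_trans qe; rewrite ler_piMl//; first exact: ltW.
    by lra.
  by lra.
rewrite lee_fin.
have -> : c * expR (- I * n'%:R) / 8 * (g ^+ 2) ^+ (n - n') =
  c / 8 * (expR (- I * n'%:R) * expR (ln g * (2 * (n - n')%:R))).
  rewrite mulrA expRM_natr [expR (ln g * 2)]expRM_natr lnK ?posrE//.
  by ring.
have -> : c / 8 * g ^+ 2 * expR (- (rate_below x + d) * n%:R) =
  c / 8 * (expR (ln g * 2) * expR (- (rate_below x + d) * n%:R)).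
  by rewrite expRM_natr lnK ?posrE//; ring.
rewrite ler_pM2l ?divr_gt0// -!expRD ler_expR natrB//.
have h1 := ler_wpM2r n0 cost.
have h2 : I * n'%:R <= I * (tau * n%:R) by rewrite ler_wpM2l.
have h3 : ln g * (1 + (1 - tau) * n%:R) <= ln g * (n%:R - n'%:R).
  by rewrite ler_wnM2l//; [exact: ltW|lra].
by lra.
Qed.

End lower_bound.

(** * From Lebesgue measure to the chain *)

Section measure_link.
Context {R : realType}.
Implicit Types (t r x y z a p u : R) (b k n m : nat).
Local Notation mu := (@lebesgue_measure R).

Definition affine a p : measurableTypeR R -> measurableTypeR R :=
  fun u => a - p * u.

Lemma measurable_affine a p : measurable_fun setT (affine a p).
Proof. by apply: measurable_funB => //; exact: measurable_funM. Qed.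

Lemma lebesgue_measure_affine a p (S : set (measurableTypeR R)) :
  0 < p -> measurable S ->
  mu S = (p%:E * mu (affine a p @^-1` S))%E.
Proof.
move=> p0 mS; have mf := @measurable_affine a p.
pose m : {measure set (measurableTypeR R) -> \bar R} :=
  mscale (NngNum (ltW p0))
    (measure_function_pushforward__canonical__measure_function_Measure mu mf).
rewrite (@lebesgue_measure_unique _ m) // => _ [[x y] _ <-]/=.
rewrite /m /mscale/= /pushforward.
have -> : affine a p @^-1` `]x, y] = `[(a - y) / p, (a - x) / p[%classic.
  apply/seteqP; split => u /=; rewrite !in_itv/= /affine ler_pdivrMr//
    ltr_pdivlMr// => /andP[? ?]; apply/andP; split; lra.
rewrite !lebesgue_measure_itv/= !lte_fin ltr_pM2r ?invr_gt0// ltrD2l ltrN2.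
case: ifP => _; last by rewrite mule0.
by rewrite -!EFinD -EFinM; congr EFin; field; rewrite gt_eqF.
Qed.

(** Inverse of the distribution function (b + r) t / (1 + r t) of the law
    (b, r): it transports the uniform law on (0, 1) to the law (b, r). *)
Definition quantile b r u : R := u / (b%:R + r - r * u).

Lemma measurable_quantile b r :
  measurable_fun [set: measurableTypeR R] (quantile b r : _ -> measurableTypeR R).
Proof.
apply: measurable_funM => //.
apply: (measurableT_comp (@measurable_invr R)).
by apply: measurable_funB => //; exact: measurable_funM.
Qed.

Definition ecf_event (H : set R) n : set (measurableTypeR R) :=
  [set t | H (ecf_b n t)%:~R].

Lemma measurable_ecf_event (H : set (measurableTypeR R)) n : measurable H ->
  measurable (ecf_event H n).
Proof.
move=> mH; rewrite -[ecf_event H n]setTI.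
by apply: (measurableT_comp (@measurable_ecf_b1 R) (@measurable_ecf_iter R n.-1)).
Qed.

Definition quantile_event (H : set R) n b r : set (measurableTypeR R) :=
  `]0, 1[ `&` [set u | ecf_event H n (quantile b r u)].

Lemma measurable_quantile_event (H : set (measurableTypeR R)) n b r :
  measurable H -> measurable (quantile_event H n b r).
Proof.
move=> mH; apply: measurableI => //.
rewrite -[X in measurable X]setTI; apply: measurable_quantile => //.
exact: measurable_ecf_event.
Qed.

Section branch.
Variables (b : nat) (r : R) (s : state b r) (j : nat).
Local Notation k := (b + j)%N.
Local Notation c := (b%:R + r).
Local Notation h := (k%:R + r).
Local Notation p := (step_prob b r k).

Let branch_bounds : [/\ 0 < c, 1 <= k%:R :> R, 0 <= r, c <= h & 0 < p].
Proof.
have /andP[r0 r1] := state_r s; have b0 := state_gt0 s.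
have k1 : 1 <= k%:R :> R by rewrite (le_trans (state_ge1 s))// ler_nat leq_addr.
split => //; [lra|by rewrite lerD2r ler_nat leq_addr|].
by rewrite /step_prob; apply: divr_gt0; [|apply: mulr_gt0]; lra.
Qed.

(** On the branch b_1 = k, the passage from u to the coordinate u' of the image
    under T_E is affine, because both coordinates are uniform:
    u = c / h - p u', where c = b + r and h = k + r. *)
Lemma branchE u : c / h - p * u = c * (h + 1 - u) / (h * (h + 1)).
Proof.
have [c0 k1 r0 ch p0] := branch_bounds.
by rewrite /step_prob; field; rewrite !gt_eqF//; lra.
Qed.

Lemma branch_preimage :
  affine (c / h) p @^-1` `]c / (h + 1), c / h] = `[0, 1[%classic.
Proof.
have [c0 k1 r0 ch p0] := branch_bounds.
have -> : c / (h + 1) = c / h - p * 1 by rewrite branchE; field; rewrite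
  !gt_eqF//; lra.
apply/seteqP; split => u /=; rewrite !in_itv/= ltrD2l ltrN2 (ltr_pM2l p0) gerBl
  (pmulr_rge0 _ p0) andbC//.
Qed.

Lemma branch_in01 u : 0 < u < 1 -> 0 < c / h - p * u < 1.
Proof.
have [c0 k1 r0 ch p0] := branch_bounds.
move=> /andP[u0 u1]; rewrite branchE; apply/andP; split.
  by rewrite divr_gt0 ?mulr_gt0//; lra.
rewrite ltr_pdivrMr; last by apply: mulr_gt0; lra.
have h1 : 0 <= (h + 1 - u) * (h - c) by apply: mulr_ge0; lra.
have h2 : 0 < h * u by apply: mulr_gt0; lra.
by lra.
Qed.

Lemma quantile_branch_inv u : 0 < u < 1 ->
  (quantile b r (c / h - p * u))^-1 = k%:R + h * u / (h + 1 - u).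
Proof.
have [c0 k1 r0 ch p0] := branch_bounds.
move=> /andP[u0 u1]; rewrite branchE /quantile.
have d0 : 0 < h * (h + 1) - r * (h + 1 - u) by nra.
by field; rewrite !gt_eqF//; nra.
Qed.

Lemma ecf_b1_branch u : 0 < u < 1 -> ecf_b1 (quantile b r (c / h - p * u)) = k.
Proof.
have [c0 k1 r0 ch p0] := branch_bounds.
move=> u01; rewrite /ecf_b1 quantile_branch_inv//.
have /andP[u0 u1] := u01.
apply: floor_def; rewrite intrD/= -pmulrn; apply/andP; split.
  by rewrite lerDl divr_ge0 ?mulr_ge0//; lra.
by rewrite ltrD2l ltr_pdivrMr; nra.
Qed.

(** The law obtained after one step is again of the family, with parameters
    (k, next_r k r). *)
Lemma ecf_map_branch u : 0 < u < 1 ->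
  ecf_map (quantile b r (c / h - p * u)) = quantile k (next_r k r) u.
Proof.
have [c0 k1 r0 ch p0] := branch_bounds.
move=> u01; rewrite /ecf_map ecf_b1_branch// quantile_branch_inv// /quantile
  /next_r.
have /andP[u0 u1] := u01; rewrite -pmulrn.
by field; rewrite !gt_eqF//; nra.
Qed.

(** The affine change of variable contributes the factor p. The branch is the
    image of [0, 1), and its endpoint u' = 0, sent to the point 0 where the
    expansion stops, is discarded as a null set. *)
Lemma quantile_event_branch (H : set R) n : measurable (H : set (measurableTypeR
  R)) ->
  mu (quantile_event H n.+1 b r `&` `]c / (h + 1), c / h]) =
  (p%:E * (if n is 0 then event [set k | H k%:R] k r
           else mu (quantile_event H n k (next_r k r))))%E.
Proof.
have [c0 k1 r0 ch p0] := branch_bounds.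
move=> mH; have mX : measurable (quantile_event H n.+1 b r `&` `]c / (h + 1), c /
  h]%classic).
  by apply: measurableI => //; exact: measurable_quantile_event.
rewrite (lebesgue_measure_affine (c / h) p0 mX); congr (_ * _)%E.
set X := affine _ _ @^-1` _.
have mX' : measurable X by rewrite -[X]setTI; exact: measurable_affine.
have X01 u : X u -> 0 <= u < 1.
  move=> [_]; rewrite -[_ (affine _ _ u)]/((affine (c / h) p @^-1` `]c / (h + 1),
    c / h]) u).
  by rewrite branch_preimage /= in_itv.
have XE u : 0 < u < 1 -> X u <-> ecf_event H n.+1 (quantile b r (c / h - p * u)).
  move=> u01; split => [[[]]//|Hu]; split; first by split => //=; rewrite
    in_itv/= branch_in01.
  rewrite -[_ (affine _ _ u)]/((affine (c / h) p @^-1` `]c / (h + 1), c / h]) u).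
  by rewrite branch_preimage/= in_itv/=; case/andP: u01 => /ltW -> ->.
pose T := X `&` `]0, 1[%classic.
have mT : measurable T by exact: measurableI.
have -> : mu X = mu T.
  have -> : X = T `|` (X `&` [set 0]).
    apply/seteqP; split => u; last by case => -[].
    move=> Xu; have /andP[u0 u1] := X01 _ Xu.
    move: u0; rewrite le_eqVlt => /predU1P[u0|u0]; first by right.
    by left; split => //=; rewrite in_itv/= u0.
  rewrite measureU0//; first by apply: measurableI.
  apply: (@subset_measure0 _ _ _ mu _ [set 0]) => //; first exact: measurableI.
  exact: lebesgue_measure_set1.
rewrite /T; case: n mX X mX' X01 XE T mT => [|n] mX X mX' X01 XE T mT.
- have HE u : 0 < u < 1 -> X u <-> H k%:R.
    by move=> u01; rewrite XE// /ecf_event/= /ecf_b/= ecf_b1_branch.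
  rewrite /event indicE; case: (boolP (k \in _)) => [/set_mem/= Hk|Hk].
    have -> : X `&` `]0, 1[ = `]0, 1[%classic.
      apply/seteqP; split => u; first by case.
      by rewrite /= in_itv/= => u01; split => //; apply/HE.
    by rewrite lebesgue_measure_itv/= lte01 sube0.
  have -> : X `&` `]0, 1[ = set0.
    apply/seteqP; split => u // -[Xu]; rewrite /= in_itv/= => u01.
    by case/negP: Hk; apply/mem_set/(HE u).
  by rewrite measure0.
- congr (mu _); apply/seteqP; split => u.
    move=> [Xu] u01'; split => //; move: u01'; rewrite /= in_itv/= => u01.
    by move: Xu; rewrite XE// /ecf_event/= /ecf_b -pred_Sn iterSr ecf_map_branch.
  move=> [u01' Hu]; split => //; move: u01'; rewrite /= in_itv/= => u01.
  by rewrite XE// /ecf_event/= /ecf_b -pred_Sn iterSr ecf_map_branch.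
Qed.

End branch.

(** The branches, for k >= b, cut (0, 1) into disjoint intervals. *)
Lemma quantile_event_transfer (H : set R) n b r :
  measurable (H : set (measurableTypeR R)) -> state b r ->
  mu (quantile_event H n.+1 b r) =
  transfer (fun k r => if n is 0 then event [set k | H k%:R] k r
                       else mu (quantile_event H n k r)) b r.
Proof.
move=> mH s; have b0 := state_gt0 s; have /andP[r0 r1] := state_r s.
have c0 : 0 < b%:R + r by lra.
pose J j := `](b%:R + r) / ((b + j)%:R + r + 1), (b%:R + r) / ((b + j)%:R +
  r)]%classic : set (measurableTypeR R).
have h0 j : 0 < (b + j)%:R + r by rewrite natrD -addrA ltr_pwDl// addr_ge0.
have h1 j : 0 < (b + j)%:R + r + 1 by rewrite ltr_wpDl// ltW.
have -> : quantile_event H n.+1 b r = \bigcup_j (quantile_event H n.+1 b r `&` J j).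
  rewrite -setI_bigcupr; apply/esym/setIidl => u [].
  rewrite /= in_itv/= => /andP[u0 u1] _.
  have ub : b%:R < (b%:R + r) / u - r by rewrite ltrBrDr ltr_pdivlMr// gtr_pMr.
  have /andP[k1 k2] := @truncn_itv _ ((b%:R + r) / u - r) (le_trans (ltW b0) (ltW
    ub)).
  set k := Num.truncn _ in k1 k2.
  have bk : (b <= k)%N.
    by rewrite -ltnS -(ltr_nat R); exact: lt_trans ub k2.
  exists (k - b)%N => //; rewrite /J/= in_itv/= subnKC//.
  have k0 : 0 < k%:R + r by have := h0 (k - b)%N; rewrite subnKC.
  rewrite ltr_pdivrMr ?ler_pdivlMr//; last by rewrite addr_gt0.
  move: k1 k2; rewrite lerBrDr ler_pdivlMr// ltrBlDr ltr_pdivrMr// -natr1 addrAC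
    => k1 k2.
  by rewrite mulrC k2 mulrC.
have mF j : measurable (quantile_event H n.+1 b r `&` J j).
  by apply: measurableI; [exact: measurable_quantile_event|exact: measurable_itv].
rewrite measure_semi_bigcup//; last 2 first.
- apply: ltn_trivIset => i j ij; apply/seteqP; split => u // -[[_ +] [_]].
  rewrite /J/= !in_itv/= => /andP[h2 _] /andP[_ h3].
  have := lt_le_trans h2 h3; rewrite ltr_pM2l// ltf_pV2 ?posrE//.
  rewrite addrAC ltrD2r natr1 ltr_nat ltnS addnC [(b + _)%N]addnC.
  by rewrite leq_add2r leqNgt ij.
- exact: bigcupT_measurable.
rewrite /transfer; apply: eq_eseriesr => j _.
by apply: (etrans (@quantile_event_branch b r s j H n mH)); case: n {mF}.
Qed.

Lemma quantile_event_iter (H : set R) n b r :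
  measurable (H : set (measurableTypeR R)) -> state b r ->
  mu (quantile_event H n.+1 b r) = iter n.+1 transfer (event [set k | H k%:R]) b r.
Proof.
move=> mH; elim: n b r => [|n ih] b r s; rewrite quantile_event_transfer//.
exact: eq_transfer.
Qed.

End measure_link.

Section law.
Context {R : realType}.
Implicit Types (x c : R) (k n : nat) (G : set R).
Local Notation P := (@lebesgue01 R).

Definition log_event G n : set nat := [set k | G ((ln k%:R - n%:R) / n%:R)].

(** The uniform law is the law (1, 0), since quantile 1 0 is the identity; the
    endpoint 1 of (0, 1] is a null set. *)
Lemma lebesgue01_ecf G n : measurable (G : set (measurableTypeR R)) -> (0 < n)%N ->
  P (@ecf_log_dev R n @^-1` G) = iter n transfer (event (log_event G n)) 1%N 0.
Proof.
case: n => // n mG _.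
pose f : measurableTypeR R -> measurableTypeR R := fun v => (ln v - n.+1%:R) /
  n.+1%:R.
have mf : measurable_fun setT f.
  by apply: measurable_funM => //; apply: measurable_funB => //; exact:
    measurable_ln.
pose H : set R := f @^-1` G.
have mH : measurable (H : set (measurableTypeR R)).
  by rewrite -[H]setTI; exact: mf.
have s10 : state 1 (0 : R) by rewrite /state lexx ler01.
rewrite -[event _]/(event [set k | H k%:R]) -quantile_event_iter//.
rewrite /lebesgue01 /mrestr.
have -> : @ecf_log_dev R n.+1 @^-1` G `&` `]0, 1] =
  quantile_event H n.+1 1 0 `|` (@ecf_log_dev R n.+1 @^-1` G `&` [set 1]).
  have q1 u : quantile 1 0 u = u by rewrite /quantile addr0 mul0r subr0 divr1.
  apply/seteqP; split => u.
    move=> [Gu]; rewrite /= in_itv/= => /andP[u0].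
    rewrite le_eqVlt => /predU1P[u1|u1]; first by right; split.
    by left; split; [rewrite /= in_itv/= u0|rewrite /= q1].
  case=> [[u01 Gu]|[Gu u1]].
    split; first by move: Gu; rewrite /= q1.
    by move: u01; rewrite /= !in_itv/= => /andP[-> /ltW ->].
  by split => //; rewrite u1 /= in_itv/= ltr01 lexx.
have mX : measurable (@ecf_log_dev R n.+1 @^-1` G).
  by rewrite -[X in measurable X]setTI; exact: measurable_ecf_log_dev.
rewrite measureU0//; first exact: measurable_quantile_event.
  exact: measurableI.
apply: (@subset_measure0 _ _ _ (@lebesgue_measure R) _ [set 1]) => //; first
  exact: measurableI.
exact: lebesgue_measure_set1.
Qed.

End law.

(** * Exponential rates and upper and lower limits *)

Section exponential_rates.
Context {R : realType}.
Implicit Types (c e : R) (n : nat) (p u : nat -> \bar R).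

Lemma limn_esup_le u c :
  (forall e, 0 < e -> exists N, forall n, (N <= n)%N -> (u n <= (c + e)%:E)%E) ->
  (limn_esup u <= c%:E)%E.
Proof.
move=> uc; apply/lee_addgt0Pr => e /uc[N HN]; rewrite -EFinD.
rewrite /limn_esup limf_esupE; apply: le_trans (ereal_inf_lbound _) _.
  exists [set n | (N <= n)%N] => //; by exists N.
by apply: ge_ereal_sup => _ [n /= Nn <-]; exact: HN.
Qed.

Lemma scaled_lne_exp c C n : 0 < C -> (0 < n)%N ->
  ((n%:R^-1)%:E * lne (C * expR (- c * n%:R))%:E)%E = (ln C / n%:R - c)%:E.
Proof.
move=> C0 n0; rewrite lne_EFin ?mulr_gt0 ?expR_gt0// lnM ?posrE ?expR_gt0// expRK.
by rewrite -EFinM; congr EFin; field; rewrite pnatr_eq0 -lt0n.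
Qed.

Lemma ln_div_small C e : 0 < e -> exists N, forall n, (N <= n)%N -> `|ln C /
  n%:R| <= e.
Proof.
move=> e0; exists (Num.truncn (`|ln C| / e)).+1 => n Nn.
have n0 : 0 < n%:R :> R by rewrite ltr0n (leq_trans _ Nn).
rewrite normrM normfV (gtr0_norm n0) ler_pdivrMr// mulrC -ler_pdivrMr//.
by apply: ltW; apply: lt_le_trans (truncnS_gt _) _; rewrite ler_nat.
Qed.

Lemma limn_esup_rate p c C : 0 < C -> (forall n, 0 <= p n)%E ->
  (exists N, forall n, (N <= n)%N -> (p n <= (C * expR (- c * n%:R))%:E)%E) ->
  (limn_esup (fun n => ((n%:R^-1)%:E * lne (p n))%E) <= (- c)%:E)%E.
Proof.
move=> C0 p0 [N HN]; apply: limn_esup_le => e /(ln_div_small C)[M HM].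
exists (maxn 1 (maxn N M)) => n; rewrite !geq_max => /and3P[n0 Nn Mn].
apply: (@le_trans _ _ ((n%:R^-1)%:E * lne (C * expR (- c * n%:R))%:E)%E).
  rewrite lee_wpmul2l ?lee_fin ?invr_ge0// lee_lne ?HN// in_itv/= ?p0 leey//.
  by rewrite lee_fin mulr_ge0 ?expR_ge0 ?ltW.
rewrite scaled_lne_exp// lee_fin.
by have := HM n Mn; rewrite ler_norml => /andP[_ ?]; lra.
Qed.

Lemma limn_einf_rate p c C : 0 < C -> (forall n, 0 <= p n)%E ->
  (exists N, forall n, (N <= n)%N -> ((C * expR (- c * n%:R))%:E <= p n)%E) ->
  ((- c)%:E <= limn_einf (fun n => ((n%:R^-1)%:E * lne (p n))%E))%E.
Proof.
move=> C0 p0 [N HN]; rewrite /limn_einf EFinN leeN2.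
apply: limn_esup_le => e /(ln_div_small C)[M HM].
exists (maxn 1 (maxn N M)) => n; rewrite !geq_max => /and3P[n0 Nn Mn].
rewrite leeNl -EFinN.
apply: (@le_trans _ _ ((n%:R^-1)%:E * lne (C * expR (- c * n%:R))%:E)%E); last
  first.
  rewrite lee_wpmul2l ?lee_fin ?invr_ge0// lee_lne ?HN// in_itv/= ?p0 leey//.
  by rewrite lee_fin mulr_ge0 ?expR_ge0 ?ltW.
rewrite scaled_lne_exp// lee_fin.
by have := HM n Mn; rewrite ler_norml => /andP[? _]; lra.
Qed.

End exponential_rates.

(** * The rate function *)

Section rate_function.
Context {R : realType}.
Implicit Types (x c : R).
Local Notation g := (@golden R).

Lemma ecf_rateE x : ecf_rate x = if -1 <= x then (rate x)%:E else +oo%E.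
Proof.
have /andP[ga gb] := @golden_bounds R.
rewrite /ecf_rate /rate -/golden; case: ifPn => gx.
  by rewrite ifT//; lra.
case: ifPn => // _; congr EFin; rewrite /rate_below.
have -> : (Num.sqrt 5 + 1) / 2 = 1 + g by rewrite /golden; lra.
by [].
Qed.

(** The line is the tangent of the strictly convex branch at - g: with
    y = (x + 1) (1 + g)^2 the inequality reads ln y <= y - 1. *)
Lemma rate_below_le x : -1 < x -> rate_below x <= x - ln (x + 1).
Proof.
move=> x1; have g0 := @golden_gt0 R; have g2 := @golden_sqr R.
have y0 : 0 < (x + 1) * (1 + g) ^+ 2 by rewrite mulr_gt0 ?exprn_gt0//; lra.
have := le_lnB1 y0; rewrite lnM ?posrE ?exprn_gt0//; [|lra..].
rewrite lnXn; last lra.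
have -> : (1 + g) ^+ 2 = 2 + g by rewrite sqrrD expr1n g2; lra.
by rewrite /rate_below; lra.
Qed.

Lemma rate_ge_below x : -1 <= x -> rate_below x <= rate x.
Proof.
move=> x1; rewrite /rate; case: ifPn => // gx; apply: rate_below_le.
by have /andP[ga gb] := @golden_bounds R; lra.
Qed.

Lemma rate_ge0 x : -1 <= x -> 0 <= rate x.
Proof.
move=> x1; have /andP[ga gb] := @golden_bounds R; rewrite /rate; case: ifPn => gx.
  by have := @le_lnB1 R (x + 1); lra.
rewrite -leNgt in gx.
have h : rate_below (- g) <= rate_below x.
  by rewrite /rate_below lerD2r -subr_ge0; nra.
apply: le_trans h; rewrite /rate_below ln_1golden.
have -> : - g + 1 = g ^+ 2 by rewrite golden_sqr addrC.
have : (1 + g) * g ^+ 2 = g.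
  by rewrite -golden_inv expr2 mulrA mulVf ?mul1r// gt_eqF//; lra.
have : ln g <= g - 1 by apply: le_lnB1; lra.
lra.
Qed.

Lemma rate0 : rate 0 = 0 :> R.
Proof.
rewrite /rate ifT; first by rewrite sub0r add0r ln1 oppr0.
by have /andP[ga gb] := @golden_bounds R; lra.
Qed.

Lemma continuous_rate_above x : -1 < x -> {for x, continuous (fun y : R => y - ln
  (y + 1))}.
Proof.
move=> x1; apply: continuousB; first exact: cvg_id.
apply: (@continuous_comp _ _ _ (fun y : R => y + 1) (@ln R)).
  by apply: continuousD; [exact: cvg_id|exact: cvg_cst].
by apply: continuous_ln; lra.
Qed.

Lemma continuous_rate_below x : {for x, continuous (@rate_below R)}.
Proof.
apply: continuousD; last exact: cvg_cst.
apply: continuousM; first exact: cvg_cst.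
by apply: continuousD; [exact: cvg_id|exact: cvg_cst].
Qed.

(** At and to the left of - g, the lower bound by the affine branch, valid on
    both sides of - g, spares the continuity at the junction point. *)
Lemma lower_semicontinuous_ecf_rate : lower_semicontinuous (@ecf_rate R).
Proof.
have /andP[ga gb] := @golden_bounds R.
move=> x a; rewrite ecf_rateE; case: ifPn => [x1|]; last first.
  rewrite -ltNge => x1 _; exists [set y | y < -1].
    by apply: open_nbhs_nbhs; split => //; exact: open_lt.
  by move=> y /= y1; rewrite ecf_rateE leNgt y1/= ltry.
rewrite lte_fin {1}/rate; case: ifPn => gx ax.
  have : \forall y \near x, a < y - ln (y + 1).
    have x1' : -1 < x by lra.
    exact: (cvgr_gt _ (continuous_rate_above x1')).
  move=> h1; have h2 : \forall y \near x, - g < y by exact: lt_nbhsr.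
  exists ([set y | a < y - ln (y + 1)] `&` [set y | - g < y]); first exact:
    filterI h1 h2.
  move=> y /= [ay gy]; rewrite ecf_rateE ifT; last lra.
  by rewrite lte_fin /rate gy.
have h1 : \forall y \near x, a < rate_below y.
  exact: (cvgr_gt _ (@continuous_rate_below x)).
exists [set y | a < rate_below y] => // y /= ay; rewrite ecf_rateE.
case: ifPn => y1; last by rewrite ltry.
by rewrite lte_fin (lt_le_trans ay)// rate_ge_below.
Qed.

Lemma good_rate_function_ecf : good_rate_function (@ecf_rate R).
Proof.
split.
- move=> x; rewrite ecf_rateE; case: ifPn => // x1.
  by rewrite lee_fin rate_ge0.
- exact: lower_semicontinuous_ecf_rate.
move=> c; apply: (@subclosed_compact _ _ `[-1, 2 * `|c| + 2]%classic).
- have -> : [set x | (ecf_rate x <= c%:E)%E] = ~` [set x | (c%:E < ecf_rate x)%E].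
    by apply/seteqP; split => x /=; rewrite leNgt => /negP.
  apply: open_closedC.
  by have /lower_semicontinuousP := lower_semicontinuous_ecf_rate; apply.
- exact: segment_compact.
move=> x /=; rewrite ecf_rateE; case: ifPn => // x1; rewrite lee_fin in_itv/=
  x1/= => rc.
have c0 : 0 <= `|c| by [].
have cc := ler_norm c.
have /andP[ga gb] := @golden_bounds R.
have [x0|x0] := leP x 0; first lra.
move: rc; rewrite /rate ifT; last lra.
have x10 : 0 < x + 1 by lra.
have := @le_lnB1 R ((x + 1) / 2); rewrite divr_gt0// ln_div ?posrE// => /(_ isT) h1.
have h2 := @le_lnB1 R 2 (ltr0n R 2).
lra.
Qed.

End rate_function.

(** * The large deviation bounds *)

Section bounds.
Context {R : realType}.
Implicit Types (x c : R) (k n : nat) (G A : set R).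

Lemma closure_inf A : has_inf A -> closure A (inf A).
Proof.
move=> hA B /nbhs_ballP[e /= e0 eB].
have [y Ay ye] := inf_adherent e0 hA.
exists y; split => //; apply: eB; rewrite /ball/= ltr_distlC.
have := ge_inf hA.2 Ay; lra.
Qed.

Lemma closure_sup A : has_sup A -> closure A (sup A).
Proof.
move=> hA B /nbhs_ballP[e /= e0 eB].
have [y Ay ye] := sup_adherent e0 hA.
exists y; split => //; apply: eB; rewrite /ball/= ltr_distlC.
have := sup_upper_bound hA Ay; lra.
Qed.

Lemma iter_event_le n (A B : set nat) (C : \bar R) r : 0 <= r <= 1 ->
  (forall k, (0 < k)%N -> A k -> B k) ->
  (iter n transfer (event B) 1%N r <= C)%E -> (iter n transfer (event A) 1%N r <=
    C)%E.
Proof.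
move=> r01 AB; apply: le_trans; have s : state 1 r by rewrite /state.
apply: le_iter_transfer => // b r' s'; first exact: event_ge0.
rewrite lee_fin !indicE; case: (boolP (b \in A)) => // /set_mem /AB Bb.
by rewrite (mem_set (Bb _))//; case/andP: s'.
Qed.

Lemma iter_event_empty n (A : set nat) (C : R) r : 0 <= C -> 0 <= r <= 1 ->
  (forall k, (0 < k)%N -> ~ A k) -> (iter n transfer (event A) 1%N r <= C%:E)%E.
Proof.
move=> C0 r01 A0; have s : state 1 r by rewrite /state.
apply: (@le_trans _ _ (iter n transfer (fun b r => 0%:E * event A b r)%E 1%N r)).
  apply: le_iter_transfer => // b r' s'; first exact: event_ge0.
  rewrite mul0e lee_fin indicE memNset//; apply: A0; by case/andP: s'.
rewrite iter_transferZ//; last by move=> *; exact: event_ge0.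
by rewrite mul0e lee_fin.
Qed.

Definition nonneg_part G : set R := G `&` [set x | 0 <= x].

Definition neg_part G : set R := G `&` [set x | x < 0].

Section upper.
Variables (G : set R) (c : R).
Hypothesis cG : forall x, closure G x -> (c%:E < ecf_rate x)%E.

(** The rate function increases on the right of 0, so that the infimum of the
    nonnegative part of G, a point of its closure, decides. It is not 0 because
    the rate function vanishes at 0 and c > 0. *)
Lemma upper_right : 0 < c -> exists2 C, 0 < C & forall n, (0 < n)%N ->
  (iter n transfer (event (log_event (nonneg_part G) n)) 1%N 0%R
    <= (C * expR (- c * n%:R))%:E)%E.
Proof.
move=> c0; have r00 : 0 <= (0 : R) <= 1 by rewrite lexx ler01.
set A := nonneg_part G; have [A0|/set0P/negP/negPn/eqP A0] := pselect (A !=set0);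
  last first.
  exists 1 => // n _; apply: iter_event_empty r00 _; first by rewrite mulr_ge0
    ?expR_ge0.
  by move=> k _; rewrite /log_event A0.
have hA : has_inf A by split => //; exists 0 => y [].
have x0 : 0 <= inf A by apply: lb_le_inf => // y [].
have GA : closure G (inf A) by apply: closure_subset (closure_inf hA) => y [].
have := cG GA; rewrite ecf_rateE ifT; last lra.
have /andP[ga gb] := @golden_bounds R.
rewrite lte_fin /rate ifT; last lra.
move: x0; rewrite le_eqVlt => /predU1P[<-|x0]; first by rewrite sub0r add0r ln1;
  lra.
move=> /(right_tail x0)[C C0 HC]; exists C => // n n0.
have n0' : 0 < n%:R :> R by rewrite ltr0n.
apply: iter_event_le (HC n 0 r00) => // k k0 Ak; rewrite /log_ge/=.
have := ge_inf hA.2 Ak; rewrite ler_pdivlMr//; lra.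
Qed.

(** Symmetrically, the supremum of the negative part decides; if it is below -1
    the event is empty, since ln b_n >= 0. *)
Lemma upper_left : 0 < c -> exists2 C, 0 < C & forall n, (0 < n)%N ->
  (iter n transfer (event (log_event (neg_part G) n)) 1%N 0%R
    <= (C * expR (- c * n%:R))%:E)%E.
Proof.
move=> c0; have r00 : 0 <= (0 : R) <= 1 by rewrite lexx ler01.
set A := neg_part G; have [A0|/set0P/negP/negPn/eqP A0] := pselect (A !=set0);
  last first.
  exists 1 => // n _; apply: iter_event_empty r00 _; first by rewrite mulr_ge0
    ?expR_ge0.
  by move=> k _; rewrite /log_event A0.
have hA : has_sup A by split => //; exists 0 => y [_ /= /ltW].
have x0 : sup A <= 0 by apply: sup_le_ub => // y [_ /= /ltW].
have GA : closure G (sup A) by apply: closure_subset (closure_sup hA) => y [].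
have := cG GA; rewrite ecf_rateE; case: ifPn => [x1|]; last first.
  rewrite -ltNge => x1 _; exists 1 => // n n0.
  apply: iter_event_empty r00 _; first by rewrite mulr_ge0 ?expR_ge0.
  move=> k k0 Ak; have := sup_upper_bound hA Ak.
  have n0' : 0 < n%:R :> R by rewrite ltr0n.
  have : 0 <= ln k%:R :> R by rewrite ln_ge0// ler1n.
  rewrite ler_pdivrMr//; nra.
rewrite lte_fin.
move: x0; rewrite le_eqVlt => /predU1P[->|x0]; first by rewrite rate0; lra.
have x10 : -1 <= sup A < 0 by rewrite x1.
move=> /(left_tail x10)[C C0 HC]; exists C => // n n0.
have n0' : 0 < n%:R :> R by rewrite ltr0n.
apply: iter_event_le (HC n 0 r00) => // k k0 Ak; rewrite /log_le/=.
have := sup_upper_bound hA Ak; rewrite ler_pdivrMr//; lra.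
Qed.

Lemma prob_upper : measurable (G : set (measurableTypeR R)) ->
  exists2 C, 0 < C & forall n, (0 < n)%N ->
  (lebesgue01 (@ecf_log_dev R n @^-1` G) <= (C * expR (- c * n%:R))%:E)%E.
Proof.
move=> mG; have [c0|c0] := leP c 0.
  exists 1 => // n n0; apply: le_trans (probability_le1 (@lebesgue01 R) _) _.
    by rewrite -[X in measurable X]setTI; exact: measurable_ecf_log_dev.
  by rewrite mul1r lee_fin -expR0 ler_expR mulNr oppr_ge0 mulr_le0_ge0.
have [C1 C10 H1] := upper_right c0; have [C2 C20 H2] := upper_left c0.
exists (C1 + C2); first exact: addr_gt0.
move=> n n0; rewrite lebesgue01_ecf// mulrDl EFinD.
apply: le_trans _ (leeD (H1 n n0) (H2 n n0)).
have s : state 1 (0 : R) by rewrite /state lexx ler01.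
rewrite -iter_transferD//; [|by move=> *; exact: event_ge0..].
apply: le_iter_transfer => // b r s'; first exact: event_ge0.
suff : \1_(log_event G n) b <= \1_(log_event (nonneg_part G) n) b +
    \1_(log_event (neg_part G) n) b :> R by [].
rewrite !indicE; case: (boolP (b \in log_event G n)) => [/set_mem Gb|_]; last first.
  by rewrite addr_ge0.
have [h|h] := leP 0 ((ln b%:R - n%:R) / n%:R : R).
  have -> : b \in log_event (nonneg_part G) n by apply/mem_set; split.
  by rewrite lerDl.
have -> : b \in log_event (neg_part G) n by apply/mem_set; split.
by rewrite lerDr.
Qed.

End upper.

Lemma prob_lower G x d : measurable (G : set (measurableTypeR R)) ->
  G° x -> -1 <= x -> 0 < d ->
  exists2 c, 0 < c & exists N, forall n, (N <= n)%N ->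
  ((c * expR (- (rate x + d) * n%:R))%:E <= lebesgue01 (@ecf_log_dev R n @^-1`
    G))%E.
Proof.
move=> mG /nbhs_ballP[e /= e0 eG] x1 d0.
have e20 : 0 < e / 2 by rewrite divr_gt0.
have [c c0 [N HN]] := window_lower_rate x1 e20 d0.
exists c => //; exists (maxn 1 N) => n; rewrite geq_max => /andP[n0 Nn].
have n0' : 0 < n%:R :> R by rewrite ltr0n.
rewrite lebesgue01_ecf//; apply: le_trans (HN n Nn) _.
have s : state 1 (0 : R) by rewrite /state lexx ler01.
apply: le_iter_transfer => // b r s'; first exact: event_ge0.
apply: le_event => k; rewrite /window /log_event/= => hk; apply: eG.
rewrite /ball/= distrC.
have -> : (ln k%:R - n%:R) / n%:R - x = (ln k%:R - (1 + x) * n%:R) / n%:R.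
  by field; rewrite gt_eqF.
rewrite normrM normfV (gtr0_norm n0') ltr_pdivrMr//; apply: le_lt_trans hk _.
by rewrite ltr_pM2r//; lra.
Qed.

End bounds.

Theorem theorem2p1 (R : realType) :
  large_deviation_principle (@ecf_log_dev_RV R) (@ecf_rate R).
Proof.
split; first exact: good_rate_function_ecf.
move=> G mG rate_n.
have P0 n : (0 <= lebesgue01 (@ecf_log_dev R n @^-1` G))%E by exact: measure_ge0.
split.
- rewrite leeNl; apply: le_ereal_inf_tmp => _ [x Gx <-].
  rewrite ecf_rateE; case: ifPn => [x1|_]; last by rewrite leey.
  apply/lee_addgt0Pr => d d0; rewrite -EFinD leeNl -EFinN.
  have [c c0 HN] := prob_lower mG Gx x1 d0.
  exact: (limn_einf_rate c0 P0 HN).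
- exact: limn_einf_sup.
- have H c : (c%:E < ereal_inf [set ecf_rate x | x in closure G])%E ->
      (limn_esup rate_n <= (- c)%:E)%E.
    move=> cI; have [x Gx|C C0 HC] := @prob_upper R G c _ mG.
      by apply: lt_le_trans cI _; apply: ereal_inf_lbound; exists x.
    by apply: (limn_esup_rate C0 P0); exists 1%N.
  rewrite leeNr; move: H; case: ereal_inf => [i| |] H.
  + apply/lee_subgt0Pr => e e0; rewrite leeNr -EFinB -EFinN.
    by apply: H; rewrite lte_fin; rewrite gtrBl.
  + rewrite leye_eq; apply/eqP/eqyP => c c0; rewrite leeNr -EFinN.
    by apply: H; rewrite ltry.
  + exact: leNye.
Qed.
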